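(* Let $K$ be a field and $E$ an arbitrary directed graph. Then $L_K(E)$ is decomposable if and only if there exist two nontrivial hereditary and saturated subsets $H_1$ and $H_2$ of $E^0$ such that $H_1\cap H_2=\emptyset$ and, for every $v\in E^0\setminus(H_1\cup H_2)$, there exists at least one but only finitely many paths starting at $v$ which are either $H_1$-compatible or $H_2$-compatible.
   Context: Graphs. A directed graph $E=(E^0,E^1,r,s)$ consists of disjoint sets $E^0$ (vertices), $E^1$ (edges) of arbitrary cardinality and maps $r,s:E^1\to E^0$ (range, source). A vertex $v$ is a sink if $s^{-1}(v)=\emptyset$, an infinite emitter if $s^{-1}(v)$ is infinite, and regular otherwise; $\mathrm{Inf}(E)$ and $\mathrm{Reg}(E)$ denote the sets of infinite emitters and of regular vertices. A finite path (of positive length) is a sequence $\mu=\mu_1\cdots\mu_n$ of edges with $r(\mu_i)=s(\mu_{i+1})$, with $s(\mu)=s(\mu_1)$, $r(\mu)=r(\mu_n)$, $|\mu|=n$; vertices are paths of length $0$. A set $H\subseteq E^0$ is hereditary if, whenever there is a path from $v\in H$ to $w$, then $w\in H$; a hereditary set $H$ is saturated if every regular vertex $v$ with $r(s^{-1}(v))\subseteq H$ lies in $H$. ''Nontrivial'' means different from $\emptyset$ and from $E^0$. For $H$ hereditary, the set of breaking vertices is $B_H=\{v\in E^0\setminus H : v\in\mathrm{Inf}(E),\ 0<|s^{-1}(v)\cap r^{-1}(E^0\setminus H)|<\infty\}$. For $H$ hereditary and saturated, a path $\lambda=\lambda_1\cdots\lambda_{|\lambda|}$ with $\lambda_i\in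 E^1$ is $H$-compatible if $r(\lambda)\in H$ and $s(\lambda_{|\lambda|})\notin H\cup B_H$. Leavitt path algebra. $L_K(E)$ is the associative $K$-algebra generated by $E^0\cup E^1\cup\{e^*:e\in E^1\}$ subject to: $vw=\delta_{v,w}v$ for $v,w\in E^0$; $s(e)e=er(e)=e$ and $r(e)e^*=e^*s(e)=e^*$ for $e\in E^1$; $e^*e'=\delta_{e,e'}r(e)$ for $e,e'\in E^1$; $v=\sum_{s(e)=v}ee^*$ for $v\in\mathrm{Reg}(E)$. $L_K(E)$ is decomposable if there are two nonzero (two-sided) ideals $I,J$ with $L_K(E)=I\oplus J$. *)

(* Defs.v *)
From HB Require Import structures.
From mathcomp Require Import all_boot all_order all_algebra finmap.
From mathcomp Require Import boolp classical_sets functions cardinality.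

Set Implicit Arguments.
Unset Strict Implicit.
Unset Printing Implicit Defensive.

Import GRing.Theory.
Local Open Scope classical_set_scope.
Local Open Scope ring_scope.

Record digraph := Digraph {
  vertex : Type;
  edge : Type;
  src : edge -> vertex;
  rng : edge -> vertex }.

(* Vertices and edges are arbitrary types; equality tests and choice on them
   are the classical ones of boolp. *)
HB.instance Definition _ (E : digraph) := gen_eqMixin (vertex E).
HB.instance Definition _ (E : digraph) := gen_choiceMixin (vertex E).
HB.instance Definition _ (E : digraph) := gen_eqMixin (edge E).
HB.instance Definition _ (E : digraph) := gen_choiceMixin (edge E).

Section Graphs.
Context {E : digraph}.
Implicit Types (v w : vertex E) (e : edge E) (p q : seq (edge E)).
Implicit Types (H : set (vertex E)).

Definition emitted v : set (edge E) := [set e | src e = v].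

Definition sink v := emitted v = set0.
Definition infinite_emitter v := infinite_set (emitted v).
Definition regular v := ~ sink v /\ ~ infinite_emitter v.

(* [gpath v p w]: the edge sequence p is a path from v to w. The empty sequence
   is the path of length 0 at v, so a path is determined by its source v and
   its sequence of edges. *)
Fixpoint gpath v p w : Prop :=
  if p is e :: q then src e = v /\ gpath (rng e) q w else v = w.

Definition hereditary H := forall v p w, H v -> gpath v p w -> H w.

Definition saturated H :=
  forall v, regular v -> (@rng E @` emitted v) `<=` H -> H v.

Definition nontrivial H := H <> set0 /\ H <> setT.

Definition breaking H : set (vertex E) :=
  [set v | [/\ ~ H v, infinite_emitter v,
               emitted v `&` (@rng E @^-1` ~` H) !=set0 &
               finite_set (emitted v `&` (@rng E @^-1` ~` H))]].

(* The last edge e of an H-compatible path is singled out, so that such a path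
   has positive length. *)
Definition compatible_from H v : set (seq (edge E)) :=
  [set p | exists q e w, [/\ p = rcons q e, gpath v p w, H w &
                            ~ (H `|` breaking H) (src e)]].

End Graphs.

(* Associative K-algebras, not necessarily unital: a Leavitt path algebra has
   a unit only if the graph has finitely many vertices. *)
HB.mixin Record Lmodule_isNonunitalAlgebra (K : fieldType) A
    of GRing.Lmodule K A := {
  amul : A -> A -> A;
  amulA : associative amul;
  amulDl : left_distributive amul +%R;
  amulDr : right_distributive amul +%R;
  amulZl : forall (k : K) x y, amul (k *: x) y = k *: amul x y;
  amulZr : forall (k : K) x y, amul x (k *: y) = k *: amul x y }.

#[short(type="nonunitalAlgType")]
HB.structure Definition NonunitalAlgebra (K : fieldType) :=
  { A of Lmodule_isNonunitalAlgebra K A & GRing.Lmodule K A }.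

Section Ideals.
Context {K : fieldType} {A : nonunitalAlgType K}.
Implicit Types (I J : set A).

Definition two_sided_ideal I :=
  [/\ I 0,
      forall x y, I x -> I y -> I (x + y),
      forall (k : K) x, I x -> I (k *: x) &
      forall a x, I x -> I (amul a x) /\ I (amul x a)].

Definition direct_sum I J :=
  I `&` J = [set 0] /\ forall a : A, exists x y, [/\ I x, J y & a = x + y].

End Ideals.

Definition decomposable (K : fieldType) (A : nonunitalAlgType K) :=
  exists I J : set A,
    [/\ two_sided_ideal I, two_sided_ideal J,
        I <> [set 0], J <> [set 0] & direct_sum I J].

(* The non-unital associative K-algebra generated by X subject to relations R
   is the set of formal expressions over X, modulo the least congruence that
   contains R and the axioms of K-algebras. *)
Inductive expr (K : fieldType) (X : Type) :=
  | Gen of X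
  | Zero
  | Opp of expr K X
  | Add of expr K X & expr K X
  | Scale of K & expr K X
  | Mul of expr K X & expr K X.
Arguments Gen {K X}.
Arguments Zero {K X}.

HB.instance Definition _ K X := gen_eqMixin (expr K X).
HB.instance Definition _ K X := gen_choiceMixin (expr K X).

Section Presentation.
Context {K : fieldType} {X : Type} (R : expr K X -> expr K X -> Prop).

Inductive cong : expr K X -> expr K X -> Prop :=
  | cong_rel x y : R x y -> cong x y
  | cong_refl x : cong x x
  | cong_sym x y : cong x y -> cong y x
  | cong_trans x y z : cong x y -> cong y z -> cong x z
  | cong_Opp x x' : cong x x' -> cong (Opp x) (Opp x')
  | cong_Add x x' y y' : cong x x' -> cong y y' -> cong (Add x y) (Add x' y')
  | cong_Scale k x x' : cong x x' -> cong (Scale k x) (Scale k x')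
  | cong_Mul x x' y y' : cong x x' -> cong y y' -> cong (Mul x y) (Mul x' y')
  | cong_addA x y z : cong (Add x (Add y z)) (Add (Add x y) z)
  | cong_addC x y : cong (Add x y) (Add y x)
  | cong_add0 x : cong (Add Zero x) x
  | cong_addN x : cong (Add (Opp x) x) Zero
  | cong_scaleA k l x : cong (Scale k (Scale l x)) (Scale (k * l) x)
  | cong_scale1 x : cong (Scale 1 x) x
  | cong_scaleDr k x y : cong (Scale k (Add x y)) (Add (Scale k x) (Scale k y))
  | cong_scaleDl k l x : cong (Scale (k + l) x) (Add (Scale k x) (Scale l x))
  | cong_mulA x y z : cong (Mul x (Mul y z)) (Mul (Mul x y) z)
  | cong_mulDl x y z : cong (Mul (Add x y) z) (Add (Mul x z) (Mul y z))
  | cong_mulDr x y z : cong (Mul x (Add y z)) (Add (Mul x y) (Mul x z))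
  | cong_mulZl k x y : cong (Mul (Scale k x) y) (Scale k (Mul x y))
  | cong_mulZr k x y : cong (Mul x (Scale k y)) (Scale k (Mul x y)).

Definition congb : rel (expr K X) := fun x y => `[< cong x y >].

Fact congb_refl : reflexive congb.
Proof. by move=> x; apply/asboolP/cong_refl. Qed.

Fact congb_sym : symmetric congb.
Proof. by move=> x y; apply/asboolP/asboolP => /cong_sym. Qed.

Fact congb_trans : transitive congb.
Proof.
by move=> y x z /asboolP xy /asboolP yz; apply/asboolP/(cong_trans xy yz).
Qed.

Canonical congb_equiv := EquivRel congb congb_refl congb_sym congb_trans.

Definition presented := {eq_quot congb}%qT.

HB.instance Definition _ := Choice.on presented.
HB.instance Definition _ := EqQuotient.on presented.

Local Notation pi := (\pi_presented)%qT.

Lemma pi_eqP x y : pi x = pi y <-> cong x y.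
Proof. by split=> [/eqmodP/asboolP|h] //; apply/eqmodP/asboolP. Qed.

Lemma cong_repr x : cong (repr (pi x)) x.
Proof. by apply/pi_eqP; rewrite reprK. Qed.

Definition pr_zero : presented := lift_cst presented Zero.
Definition pr_opp := lift_op1 presented (@Opp K X).
Definition pr_add := lift_op2 presented (@Add K X).
Definition pr_scale (k : K) := lift_op1 presented (Scale k).
Definition pr_mul := lift_op2 presented (@Mul K X).

Canonical pi_pr_zero_morph := PiConst pr_zero.

Lemma pi_pr_opp : {morph pi : x / Opp x >-> pr_opp x}.
Proof.
by move=> x; unlock pr_opp; apply/pi_eqP/cong_sym/cong_Opp/cong_repr.
Qed.
Canonical pi_pr_opp_morph := PiMorph1 pi_pr_opp.

Lemma pi_pr_add : {morph pi : x y / Add x y >-> pr_add x y}.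
Proof.
move=> x y; unlock pr_add.
by apply/pi_eqP/cong_sym/cong_Add; apply: cong_repr.
Qed.
Canonical pi_pr_add_morph := PiMorph2 pi_pr_add.

Lemma pi_pr_scale k : {morph pi : x / Scale k x >-> pr_scale k x}.
Proof.
by move=> x; unlock pr_scale; apply/pi_eqP/cong_sym/cong_Scale/cong_repr.
Qed.
Canonical pi_pr_scale_morph k := PiMorph1 (pi_pr_scale k).

Lemma pi_pr_mul : {morph pi : x y / Mul x y >-> pr_mul x y}.
Proof.
move=> x y; unlock pr_mul.
by apply/pi_eqP/cong_sym/cong_Mul; apply: cong_repr.
Qed.
Canonical pi_pr_mul_morph := PiMorph2 pi_pr_mul.

Fact pr_addA : associative pr_add.
Proof.
by elim/quotW=> x; elim/quotW=> y; elim/quotW=> z; rewrite !piE;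
   apply/pi_eqP; exact: cong_addA.
Qed.

Fact pr_addC : commutative pr_add.
Proof.
by elim/quotW=> x; elim/quotW=> y; rewrite !piE; apply/pi_eqP; exact: cong_addC.
Qed.

Fact pr_add0 : left_id pr_zero pr_add.
Proof. by elim/quotW=> x; rewrite !piE; apply/pi_eqP; exact: cong_add0. Qed.

Fact pr_addN : left_inverse pr_zero pr_opp pr_add.
Proof. by elim/quotW=> x; rewrite !piE; apply/pi_eqP; exact: cong_addN. Qed.

HB.instance Definition _ :=
  GRing.isZmodule.Build presented pr_addA pr_addC pr_add0 pr_addN.

Fact pr_scaleA k l a : pr_scale k (pr_scale l a) = pr_scale (k * l) a.
Proof.
by elim/quotW: a => x; rewrite !piE; apply/pi_eqP; exact: cong_scaleA.
Qed.

Fact pr_scale1 : left_id 1 pr_scale.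
Proof. by elim/quotW=> x; rewrite !piE; apply/pi_eqP; exact: cong_scale1. Qed.

Fact pr_scaleDr : right_distributive pr_scale pr_add.
Proof.
by move=> k; elim/quotW=> x; elim/quotW=> y; rewrite !piE;
   apply/pi_eqP; exact: cong_scaleDr.
Qed.

Fact pr_scaleDl a k l :
  pr_scale (k + l) a = pr_add (pr_scale k a) (pr_scale l a).
Proof.
by elim/quotW: a => x; rewrite !piE; apply/pi_eqP; exact: cong_scaleDl.
Qed.

HB.instance Definition _ := GRing.Zmodule_isLmodule.Build K presented
  pr_scaleA pr_scale1 pr_scaleDr pr_scaleDl.

Fact pr_mulA : associative pr_mul.
Proof.
by elim/quotW=> x; elim/quotW=> y; elim/quotW=> z; rewrite !piE;
   apply/pi_eqP; exact: cong_mulA.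
Qed.

Fact pr_mulDl : left_distributive pr_mul pr_add.
Proof.
by elim/quotW=> x; elim/quotW=> y; elim/quotW=> z; rewrite !piE;
   apply/pi_eqP; exact: cong_mulDl.
Qed.

Fact pr_mulDr : right_distributive pr_mul pr_add.
Proof.
by elim/quotW=> x; elim/quotW=> y; elim/quotW=> z; rewrite !piE;
   apply/pi_eqP; exact: cong_mulDr.
Qed.

Fact pr_mulZl k a b : pr_mul (pr_scale k a) b = pr_scale k (pr_mul a b).
Proof.
by elim/quotW: a => x; elim/quotW: b => y; rewrite !piE;
   apply/pi_eqP; exact: cong_mulZl.
Qed.

Fact pr_mulZr k a b : pr_mul a (pr_scale k b) = pr_scale k (pr_mul a b).
Proof.
by elim/quotW: a => x; elim/quotW: b => y; rewrite !piE;
   apply/pi_eqP; exact: cong_mulZr.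
Qed.

HB.instance Definition _ := Lmodule_isNonunitalAlgebra.Build K presented
  pr_mulA pr_mulDl pr_mulDr pr_mulZl pr_mulZr.

End Presentation.

Inductive leavitt_gen (E : digraph) :=
  | Vertex of vertex E
  | Edge of edge E
  | Ghost of edge E.

Section Leavitt.
Context (K : fieldType) (E : digraph).
Implicit Types (v w : vertex E) (e f : edge E).

Let V v : expr K (leavitt_gen E) := Gen (Vertex v).
Let D e : expr K (leavitt_gen E) := Gen (Edge e).
Let G e : expr K (leavitt_gen E) := Gen (Ghost e).

Inductive leavitt_rel :
    expr K (leavitt_gen E) -> expr K (leavitt_gen E) -> Prop :=
  | leavitt_vertices v w :
      leavitt_rel (Mul (V v) (V w)) (if v == w then V v else Zero)
  | leavitt_src_edge e : leavitt_rel (Mul (V (src e)) (D e)) (D e)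
  | leavitt_edge_rng e : leavitt_rel (Mul (D e) (V (rng e))) (D e)
  | leavitt_rng_ghost e : leavitt_rel (Mul (V (rng e)) (G e)) (G e)
  | leavitt_ghost_src e : leavitt_rel (Mul (G e) (V (src e))) (G e)
  | leavitt_CK1 e f :
      leavitt_rel (Mul (G e) (D f)) (if e == f then V (rng e) else Zero)
  (* emitted v is finite as v is regular, so fset_set lists all its elements *)
  | leavitt_CK2 v : regular v ->
      leavitt_rel (V v)
        (\big[@Add K (leavitt_gen E)/Zero]_(e <- fset_set (emitted v))
           Mul (D e) (G e)).

Definition leavitt_path_algebra := presented leavitt_rel.

HB.instance Definition _ := NonunitalAlgebra.on leavitt_path_algebra.

End Leavitt.

(* Main.v *)
(** Suppose L = I + J is a direct sum of ideals, and let H1, H2 be the sets of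
    vertices lying in I, J. The component x in I of a vertex v is an idempotent
    of vLv, and for a path p from v to w the element p^* x p is the component of
    w in I. When p is long, p^* x p is a combination of closed paths at w and of
    their ghosts; an idempotent of this form is a scalar multiple of w, by
    comparing terms of extreme degree. So w lies in H1 or in H2: the paths that
    avoid both sets have bounded length. The same expansion of x shows that an
    infinite emitter sends all but finitely many of its edges to H1, or all but
    finitely many to H2, and the finiteness of compatible paths follows by
    induction on the length bound.

    Conversely, put S_i = H_i together with the v^(H_i), v in B_(H_i). Since
    H1 and H2 are disjoint, S_1 L S_2 = S_2 L S_1 = 0, so S_1 lies in the
    annihilator I of S_2 and S_2 in the annihilator J of S_1. By induction on
    the length of the compatible paths, every ideal containing S_1 and S_2
    contains all the vertices; applied to I + J and to the annihilator of a
    given element of the intersection of I and J, this yields the direct sum. *)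

Require Import Defs.
From mathcomp Require Import all_boot all_order all_algebra finmap.
From mathcomp Require Import boolp classical_sets functions cardinality.
From mathcomp Require Import zify.

Set Implicit Arguments.
Unset Strict Implicit.
Unset Printing Implicit Defensive.

Import Order.TTheory GRing.Theory Num.Theory.
Local Open Scope classical_set_scope.
Local Open Scope ring_scope.

Local Notation "x ** y" := (amul x y) (at level 40, left associativity).

Lemma finite_set_seq_bound (T : choiceType) (A : set (seq T)) :
  finite_set A -> exists n, forall p, A p -> (size p <= n)%N.
Proof.
move=> /finite_fsetP[F ->]; exists (\max_(p <- F) size p)%N => p pF.
exact: (leq_bigmax_seq (F := size) p pF).
Qed.

(** * Nonunital algebras *)

Section NonunitalAlgebraTheory.
Context {K : fieldType} {A : nonunitalAlgType K}.
Implicit Types (x y z : A) (B : set A).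

Lemma amul0l x : 0 ** x = 0.
Proof. by rewrite -{1}(scale0r 0) amulZl scale0r. Qed.

Lemma amul0r x : x ** 0 = 0.
Proof. by rewrite -{1}(scale0r 0) amulZr scale0r. Qed.

Lemma amulNl x y : (- x) ** y = - (x ** y).
Proof. by rewrite -scaleN1r amulZl scaleN1r. Qed.

Lemma amulNr x y : x ** (- y) = - (x ** y).
Proof. by rewrite -scaleN1r amulZr scaleN1r. Qed.

Lemma amulBl x y z : (x - y) ** z = x ** z - y ** z.
Proof. by rewrite amulDl amulNl. Qed.

Lemma amulBr x y z : x ** (y - z) = x ** y - x ** z.
Proof. by rewrite amulDr amulNr. Qed.

Lemma amul_suml (T : Type) (s : seq T) (P : pred T) (F : T -> A) y :
  (\sum_(i <- s | P i) F i) ** y = \sum_(i <- s | P i) F i ** y.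
Proof.
by apply: (big_morph (fun x => x ** y)) => [a b|]; rewrite ?amul0l ?amulDl.
Qed.

Lemma amul_sumr (T : Type) (s : seq T) (P : pred T) (F : T -> A) y :
  y ** (\sum_(i <- s | P i) F i) = \sum_(i <- s | P i) y ** F i.
Proof.
by apply: (big_morph (fun x => y ** x)) => [a b|]; rewrite ?amul0r ?amulDr.
Qed.

(** Built one generator at a time, so that induction over a linear combination needs no index
    set. *)
Inductive lspan B : A -> Prop :=
  | lspan0 : lspan B 0
  | lspan_cons (k : K) b x : B b -> lspan B x -> lspan B (k *: b + x).

Lemma lspan_gen B b : B b -> lspan B b.
Proof.
move=> Bb; rewrite -[b]scale1r -[X in lspan _ X]addr0.
by apply: lspan_cons => //; apply: lspan0.
Qed.

Lemma lspanD B x y : lspan B x -> lspan B y -> lspan B (x + y).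
Proof.
move=> + By; elim=> [|k b z Bb _ IH]; first by rewrite add0r.
by rewrite -addrA; apply: lspan_cons.
Qed.

Lemma lspanZ B (k : K) x : lspan B x -> lspan B (k *: x).
Proof.
elim=> [|l b z Bb _ IH]; first by rewrite scaler0; apply: lspan0.
by rewrite scalerDr scalerA; apply: lspan_cons.
Qed.

Lemma lspan_sum B (T : eqType) (s : seq T) (F : T -> A) :
  (forall i, i \in s -> lspan B (F i)) -> lspan B (\sum_(i <- s) F i).
Proof.
move=> BF; rewrite big_seq; elim/big_ind: _ => //; first exact: lspan0.
exact: lspanD.
Qed.

Lemma lspan_morph B B' (f : A -> A) :
  {morph f : x y / x + y} -> (forall k x, f (k *: x) = k *: f x) ->
  (forall b, B b -> lspan B' (f b)) -> forall x, lspan B x -> lspan B' (f x).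
Proof.
move=> fD fZ Bf x; elim=> [|k b z Bb _ IH].
  by rewrite -(scale0r (0 : A)) fZ scale0r; apply: lspan0.
by rewrite fD fZ; apply: lspanD => //; apply/lspanZ/Bf.
Qed.

Lemma lspanS B B' : B `<=` B' -> forall x, lspan B x -> lspan B' x.
Proof.
by move=> BB' x; apply: (@lspan_morph _ _ id) => // b /BB' /lspan_gen.
Qed.

Lemma lspanU B C x : lspan (B `|` C) x ->
  exists y z, [/\ lspan B y, lspan C z & x = y + z].
Proof.
elim=> [|k b a [Bb|Cb] _ [y [z [By Cz ->]]]].
- by exists 0, 0; split; rewrite ?addr0 //; apply: lspan0.
- by exists (k *: b + y), z; split; rewrite ?addrA //; apply: lspan_cons.
- by exists y, (k *: b + z); split; rewrite 1?addrCA //; apply: lspan_cons.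
Qed.

Lemma ideal_sum (T : eqType) (I : set A) (s : seq T) (F : T -> A) :
  two_sided_ideal I -> (forall i, i \in s -> I (F i)) ->
  I (\sum_(i <- s) F i).
Proof. by move=> [I0 ID _ _] IF; rewrite big_seq; elim/big_ind: _. Qed.

End NonunitalAlgebraTheory.

(** * Leavitt path algebras *)

Section LeavittPathAlgebra.
Context {K : fieldType} {E : digraph}.
Implicit Types (v w : vertex E) (e f : edge E) (p q r : seq (edge E)).
Local Notation L := (leavitt_path_algebra K E).
Local Notation ex := (expr K (leavitt_gen E)).
Local Notation pres := (presented (@leavitt_rel K E)).
Implicit Types (a b x y z : L).

Definition quo (t : ex) : L := (\pi_pres t)%qT.
Definition vtx v : L := quo (Gen (Vertex v)).
Definition edg e : L := quo (Gen (Edge e)).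
Definition gst e : L := quo (Gen (Ghost e)).

Lemma quo0 : quo Zero = 0.
Proof. by rewrite /quo piE. Qed.

Lemma quoN t : quo (Opp t) = - quo t.
Proof. exact: pi_pr_opp. Qed.

Lemma quoD t u : quo (Add t u) = quo t + quo u.
Proof. exact: pi_pr_add. Qed.

Lemma quoZ k t : quo (Scale k t) = k *: quo t.
Proof. exact: pi_pr_scale. Qed.

Lemma quoM t u : quo (Mul t u) = quo t ** quo u.
Proof. exact: pi_pr_mul. Qed.

Lemma quo_eqP t u : quo t = quo u <-> cong (@leavitt_rel K E) t u.
Proof. exact: pi_eqP. Qed.

Lemma quo_surj x : exists t, x = quo t.
Proof. by exists (repr (x : pres)); rewrite /quo reprK. Qed.

Lemma leavitt_ind (P : L -> Prop) :
  P 0 -> (forall x y, P x -> P y -> P (x + y)) ->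
  (forall k x, P x -> P (k *: x)) ->
  (forall x y, P x -> P y -> P (x ** y)) ->
  (forall v, P (vtx v)) -> (forall e, P (edg e)) -> (forall e, P (gst e)) ->
  forall x, P x.
Proof.
move=> P0 PD PZ PM Pv Pe Pg x; have [t ->] := quo_surj x.
elim: t => [[v|e|e]||t Pt|t Pt u Pu|k t Pt|t Pt u Pu].
- exact: Pv.
- exact: Pe.
- exact: Pg.
- by rewrite quo0.
- by rewrite quoN -scaleN1r; apply: PZ.
- by rewrite quoD; apply: PD.
- by rewrite quoZ; apply: PZ.
- by rewrite quoM; apply: PM.
Qed.

Lemma vtxM v w : vtx v ** vtx w = if v == w then vtx v else 0.
Proof.
rewrite -quoM; have /cong_rel/quo_eqP -> := leavitt_vertices K v w.
by case: eqP => // _; rewrite quo0.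
Qed.

Lemma vtxid v : vtx v ** vtx v = vtx v.
Proof. by rewrite vtxM eqxx. Qed.

Lemma src_edg e : vtx (src e) ** edg e = edg e.
Proof. by rewrite -quoM; apply/quo_eqP/cong_rel/leavitt_src_edge. Qed.

Lemma edg_rng e : edg e ** vtx (rng e) = edg e.
Proof. by rewrite -quoM; apply/quo_eqP/cong_rel/leavitt_edge_rng. Qed.

Lemma rng_gst e : vtx (rng e) ** gst e = gst e.
Proof. by rewrite -quoM; apply/quo_eqP/cong_rel/leavitt_rng_ghost. Qed.

Lemma gst_src e : gst e ** vtx (src e) = gst e.
Proof. by rewrite -quoM; apply/quo_eqP/cong_rel/leavitt_ghost_src. Qed.

Lemma gst_edg e f : gst e ** edg f = if e == f then vtx (rng e) else 0.
Proof.
rewrite -quoM; have /cong_rel/quo_eqP -> := leavitt_CK1 K e f.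
by case: eqP => // _; rewrite quo0.
Qed.

Lemma vtx_regular v : regular v ->
  vtx v = \sum_(e <- fset_set (emitted v)) edg e ** gst e.
Proof.
move=> /(leavitt_CK2 K)/cong_rel/quo_eqP; rewrite -/(vtx v) => ->.
rewrite (big_morph quo quoD quo0); apply: eq_bigr => e _; exact: quoM.
Qed.

Lemma vtx_edg v e : vtx v ** edg e = if src e == v then edg e else 0.
Proof.
by rewrite -src_edg amulA vtxM eq_sym; case: eqP => [->|_] //; rewrite amul0l.
Qed.

Lemma gst_vtx e v : gst e ** vtx v = if src e == v then gst e else 0.
Proof.
by rewrite -gst_src -amulA vtxM; case: eqP => // _; rewrite amul0r.
Qed.

(** * The involution exchanging edges and ghost edges *)

Fixpoint star_expr (t : ex) : ex :=
  match t with
  | Gen (Vertex v) => Gen (Vertex v)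
  | Gen (Edge e) => Gen (Ghost e)
  | Gen (Ghost e) => Gen (Edge e)
  | Zero => Zero
  | Opp t => Opp (star_expr t)
  | Add t u => Add (star_expr t) (star_expr u)
  | Scale k t => Scale k (star_expr t)
  | Mul t u => Mul (star_expr u) (star_expr t)
  end.

(** The swap permutes the defining relations: each source or range relation for [e] becomes one for
    its ghost, CK1 exchanges its two edges, and CK2 is fixed. *)
Lemma star_cong t u :
  cong (@leavitt_rel K E) t u ->
  cong (@leavitt_rel K E) (star_expr t) (star_expr u).
Proof.
elim=> {t u}; try by move=> *; econstructor; eauto.
- move=> _ _ [v w|e|e|e|e|e f|v rv] /=.
  + have := cong_rel (leavitt_vertices K w v).
    by rewrite eq_sym; case: eqP => [->|].
  + exact/cong_rel/leavitt_ghost_src.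
  + exact/cong_rel/leavitt_rng_ghost.
  + exact/cong_rel/leavitt_edge_rng.
  + exact/cong_rel/leavitt_src_edge.
  + have := cong_rel (leavitt_CK1 K f e).
    by rewrite eq_sym; case: eqP => [->|].
  + rewrite (big_morph star_expr (id1 := Zero) (op1 := @Add K _)) //=.
    exact/cong_rel/leavitt_CK2.
- by move=> x y z; apply/cong_sym/cong_mulA.
Qed.

Definition star x : L := quo (star_expr (repr (x : pres))).

Lemma star_quo t : star (quo t) = quo (star_expr t).
Proof. by apply/quo_eqP/star_cong; apply: cong_repr. Qed.

Lemma starD x y : star (x + y) = star x + star y.
Proof.
have [t ->] := quo_surj x; have [u ->] := quo_surj y.
by rewrite -quoD !star_quo -quoD.
Qed.

Lemma star0 : star 0 = 0.
Proof. by rewrite -quo0 star_quo. Qed.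

Lemma starN x : star (- x) = - star x.
Proof. by have [t ->] := quo_surj x; rewrite -quoN !star_quo -quoN. Qed.

Lemma starZ k x : star (k *: x) = k *: star x.
Proof. by have [t ->] := quo_surj x; rewrite -quoZ !star_quo -quoZ. Qed.

Lemma starM x y : star (x ** y) = star y ** star x.
Proof.
have [t ->] := quo_surj x; have [u ->] := quo_surj y.
by rewrite -quoM !star_quo -quoM.
Qed.

Lemma star_vtx v : star (vtx v) = vtx v. Proof. exact: star_quo. Qed.
Lemma star_edg e : star (edg e) = gst e. Proof. exact: star_quo. Qed.
Lemma star_gst e : star (gst e) = edg e. Proof. exact: star_quo. Qed.

Lemma starK : involutive star.
Proof.
elim/leavitt_ind => [|x y IHx IHy|k x IHx|x y IHx IHy|v|e|e].
- by rewrite !star0.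
- by rewrite !starD IHx IHy.
- by rewrite !starZ IHx.
- by rewrite !starM IHx IHy.
- by rewrite !star_vtx.
- by rewrite star_edg star_gst.
- by rewrite star_gst star_edg.
Qed.

(** Allowing every larger list [u] lets the lists of two summands be merged; for a product the list
    of the right factor is enough. *)
Lemma local_unit x : exists s : seq (vertex E), forall u, uniq u ->
  {subset s <= u} -> x ** (\sum_(v <- u) vtx v) = x.
Proof.
have unit_of a w : a ** vtx w = a -> exists s : seq (vertex E), forall u,
    uniq u -> {subset s <= u} -> a ** (\sum_(v <- u) vtx v) = a.
  move=> aw; exists [:: w] => u Uu /(_ w); rewrite mem_head => /(_ isT) wu.
  rewrite (bigD1_seq w) //= amulDr aw amul_sumr big1 ?addr0 // => v vw.
  by rewrite -aw -amulA vtxM eq_sym (negPf vw) amul0r.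
elim/leavitt_ind: x => [|x y [s IHs] [t IHt]|k x [s IHs]|x y _ [t IHt]|v|e|e].
- by exists [::] => u _ _; rewrite amul0l.
- exists (s ++ t) => u Uu stu; rewrite amulDl IHs ?IHt // => v vs; apply: stu.
    by rewrite mem_cat vs orbT.
  by rewrite mem_cat vs.
- by exists s => u Uu su; rewrite amulZl IHs.
- by exists t => u Uu tu; rewrite -amulA IHt.
- by apply: (unit_of _ v); rewrite vtxid.
- by apply: (unit_of _ (rng e)); rewrite edg_rng.
- by apply: (unit_of _ (src e)); rewrite gst_src.
Qed.

Lemma sum_vtx x : exists s : seq (vertex E), x = \sum_(v <- s) x ** vtx v.
Proof.
have [s us] := local_unit x; exists (undup s).
rewrite -amul_sumr us ?undup_uniq // => v; by rewrite mem_undup.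
Qed.

(** * Paths, ghost paths and spanning monomials *)

Fixpoint rpath p w : L := if p is e :: q then edg e ** rpath q w else vtx w.
Definition gstpath p w : L := star (rpath p w).

Lemma gstpath_nil w : gstpath [::] w = vtx w.
Proof. exact: star_vtx. Qed.

Lemma gstpath_cons e p w : gstpath (e :: p) w = gstpath p w ** gst e.
Proof. by rewrite /gstpath /= starM star_edg. Qed.

Lemma rpath_vtx p w : rpath p w ** vtx w = rpath p w.
Proof. by elim: p => [|e p IH] /=; rewrite ?vtxid // -amulA IH. Qed.

Lemma vtx_gstpath p w : vtx w ** gstpath p w = gstpath p w.
Proof. by rewrite /gstpath -[in LHS](star_vtx w) -starM rpath_vtx. Qed.

(** Sequences that are not paths from [v] to [w] give 0, so products can be computed without
    assuming that edges compose. *)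
Lemma vtx_rpath v p w :
  (gpath v p w /\ vtx v ** rpath p w = rpath p w) \/
  (~ gpath v p w /\ vtx v ** rpath p w = 0).
Proof.
elim: p v => [|e p IH] v /=; rewrite ?vtxM.
  by case: eqP => [->|]; [left|right].
rewrite amulA vtx_edg; case: eqP => [sv|ne]; last first.
  by right; split; [case|rewrite amul0l].
rewrite -(edg_rng e) -amulA.
have [[gp ->]|[ngp ->]] := IH (rng e); first by left.
by right; split; [case|rewrite amul0r].
Qed.

Lemma vtx_rpath_id v p w : gpath v p w -> vtx v ** rpath p w = rpath p w.
Proof. by move=> gp; have [[_ ->]|[]] := vtx_rpath v p w. Qed.

Lemma gstpath_vtx_id v p w : gpath v p w -> gstpath p w ** vtx v = gstpath p w.
Proof.
by move=> gp; rewrite /gstpath -[in LHS](star_vtx v) -starM vtx_rpath_id.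
Qed.

Lemma gstpath_vtx v p w :
  (gpath v p w /\ gstpath p w ** vtx v = gstpath p w) \/
  (~ gpath v p w /\ gstpath p w ** vtx v = 0).
Proof.
rewrite /gstpath -[X in _ ** X](star_vtx v) -starM.
by have [[gp ->]|[gp ->]] := vtx_rpath v p w; [left|right; rewrite star0].
Qed.

Definition mono p q w : L := rpath p w ** gstpath q w.

Lemma rpath_rcons p e w :
  rpath (rcons p e) w = rpath p (src e) ** (edg e ** vtx w).
Proof. by elim: p => [|f p IH] /=; rewrite ?amulA ?src_edg // IH !amulA. Qed.

Lemma gstpath_rcons p e w :
  gstpath (rcons p e) w = vtx w ** gst e ** gstpath p (src e).
Proof. by rewrite /gstpath rpath_rcons !starM star_vtx star_edg. Qed.

Definition monos : set L := [set x | exists p q w, x = mono p q w].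

(** The span is stable under left multiplication by generators: a ghost edge meets the first real
    edge, where CK1 applies, or joins the ghost part when there is no real edge. A sum of vertices
    that is a right unit for [x] lies in the span. *)
Lemma span_monos x : lspan monos x.
Proof.
suff step y : lspan monos y -> lspan monos (x ** y).
  have [s us] := local_unit x.
  rewrite -(us (undup s)) ?undup_uniq //; last by move=> v; rewrite mem_undup.
  apply/step/lspan_sum => v _; apply: lspan_gen; exists [::], [::], v.
  by rewrite /mono gstpath_nil /= vtxid.
have gen a : (forall p q w, lspan monos (a ** mono p q w)) ->
    forall y, lspan monos y -> lspan monos (a ** y).
  move=> ma; apply: lspan_morph => [u v|k u|_ [p [q [w ->]]]] //.
  - by rewrite amulDr.
  - by rewrite amulZr.
elim/leavitt_ind: x y => [|a b IHa IHb|k a IHa|a b IHa IHb|v|e|e] y sy.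
- by rewrite amul0l; apply: lspan0.
- by rewrite amulDl; apply: lspanD; auto.
- by rewrite amulZl; apply: lspanZ; auto.
- by rewrite -amulA; auto.
- apply: gen sy => p q w; rewrite amulA.
  have [[_ ->]|[_ ->]] := vtx_rpath v p w; last first.
    by rewrite amul0l; apply: lspan0.
  by apply: lspan_gen; exists p, q, w.
- apply: gen sy => p q w; rewrite amulA -/(rpath (e :: p) w).
  by apply: lspan_gen; exists (e :: p), q, w.
- apply: gen sy => -[|f p] q w; rewrite amulA /=.
    rewrite gst_vtx; case: eqP => [<-|_]; last by rewrite amul0l; apply: lspan0.
    apply: lspan_gen; exists [::], (rcons q e), (rng e).
    by rewrite /mono /= gstpath_rcons !amulA vtxid rng_gst.
  rewrite amulA gst_edg; case: eqP => _; last by rewrite !amul0l; apply: lspan0.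
  have [[_ ->]|[_ ->]] := vtx_rpath (rng e) p w; last first.
    by rewrite amul0l; apply: lspan0.
  by apply: lspan_gen; exists p, q, w.
Qed.

Definition corner_monos v : set L :=
  [set x | exists p q w, [/\ gpath v p w, gpath v q w & x = mono p q w]].

Lemma span_corner v x : vtx v ** x ** vtx v = x -> lspan (corner_monos v) x.
Proof.
move=> <-; have := span_monos x.
apply: (@lspan_morph _ _ _ _ (fun x => vtx v ** x ** vtx v)).
- by move=> y z; rewrite amulDr amulDl.
- by move=> k y; rewrite amulZr amulZl.
- move=> _ [p [q [w ->]]]; rewrite /mono !amulA.
  have [[gp ->]|[_ ->]] := vtx_rpath v p w; last first.
    by rewrite !amul0l; apply: lspan0.
  rewrite -amulA; have [[gq ->]|[_ ->]] := gstpath_vtx v q w; last first.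
    by rewrite amul0r; apply: lspan0.
  by apply: lspan_gen; exists p, q, w.
Qed.

(** * The degree filtration *)

Section Filtration.
Implicit Types (s t : ex).

(* The algebra acts on the K-valued functions of a vertex, a point and an
   integer. Points replace boundary paths: prolonging by an edge is the
   bijection n * nat = nat when the source is regular with n outgoing edges,
   and is recorded in the list when the source is an infinite emitter. *)
Definition point : Type := nat * seq (edge E * nat).
Implicit Types (i : point) (d : int).

Definition outgoing v : seq (edge E) := fset_set (emitted v).

Lemma mem_outgoing v e : ~ infinite_emitter v ->
  (e \in outgoing v) = (src e == v).
Proof.
move=> /contrapT fv; by rewrite /outgoing in_fset_set.
Qed.

Definition push e i : point :=
  if `[< infinite_emitter (src e) >] then (0, (e, i.1) :: i.2)
  else (i.1 * size (outgoing (src e)) + index e (outgoing (src e)), i.2)%N.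

(** The partial inverse of [push]. It fails at a sink, and at an infinite emitter [v] unless the
    counter is 0 and the list starts with an edge out of [v]. It never fails at a regular vertex,
    which is what CK2 requires. *)
Definition pop v i : option (edge E * point) :=
  if `[< infinite_emitter v >] then
    if i is (0, (e, k) :: l) then
      if src e == v then Some (e, (k, l)) else None
    else None
  else
    let r := outgoing v in
    if onth r (i.1 %% size r)%N is Some e
    then Some (e, ((i.1 %/ size r)%N, i.2)) else None.

Lemma pushK e i : pop (src e) (push e i) = Some (e, i).
Proof.
rewrite /push /pop; case: asboolP => [_|fe] /=.
  by rewrite eqxx; case: i.
have er : e \in outgoing (src e) by rewrite mem_outgoing.
have lt : (index e (outgoing (src e)) < size (outgoing (src e)))%N.
  by rewrite index_mem.
rewrite modnMDl modn_small // onthE (nth_map e) // nth_index //.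
rewrite divnMDl ?(leq_ltn_trans _ lt) // divn_small // addn0.
by case: i.
Qed.

Lemma popK v i e i' : pop v i = Some (e, i') -> src e = v /\ push e i' = i.
Proof.
rewrite /push /pop; case: (asboolP (infinite_emitter v)) => [iv|fv].
  case: i => -[|//] [|[f k] l] //; case: eqP => // fv [<- <-] /=.
  by rewrite fv; case: asboolP.
case Er: (onth _ _) => [f|] // [ef <-] /=; rewrite -{}ef {e}.
have lt : (i.1 %% size (outgoing v) < size (outgoing v))%N.
  by rewrite -onthTE Er.
have fr : nth f (outgoing v) (i.1 %% size (outgoing v))%N = f.
  exact: onth_nth.
have /eqP sf : src f == v by rewrite -mem_outgoing // -fr mem_nth.
rewrite sf; case: asboolP => // _; split => //.
rewrite -[in index _ _]fr index_uniq // ?fset_uniq //.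
by rewrite -divn_eq; case: i {Er lt fr}.
Qed.

Lemma pop_regular v i : regular v ->
  exists e i', pop v i = Some (e, i').
Proof.
move=> [nsv fv]; rewrite /pop; case: asboolP => // _.
have r0 : (0 < size (outgoing v))%N.
  case: (outgoing v) (fun e => @mem_outgoing v e fv) => // nil.
  by case: nsv; apply/seteqP; split=> // e ev; have := nil e; rewrite ev eqxx.
have := ltn_pmod i.1 r0; rewrite -onthTE; case: onth => // e _.
by exists e, ((i.1 %/ size (outgoing v))%N, i.2).
Qed.

(** * The graded representation *)

Definition graded : Type := vertex E -> point -> int -> K.
Implicit Types (F G : graded).

(** An edge shifts the integer variable up by one and a ghost edge shifts it down, so degrees can be
    bounded by looking at supports. *)
Fixpoint act t F : graded := fun v i n =>
  match t with
  | Gen (Vertex w) => if v == w then F v i n else 0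
  | Gen (Edge e) =>
      if pop v i is Some (e', i') then
        if e' == e then F (rng e) i' (n - 1) else 0
      else 0
  | Gen (Ghost e) => if v == rng e then F (src e) (push e i) (n + 1) else 0
  | Zero => 0
  | Opp t => - act t F v i n
  | Add t u => act t F v i n + act u F v i n
  | Scale k t => k * act t F v i n
  | Mul t u => act t (act u F) v i n
  end.

Lemma gradedP F G : (forall v i n, F v i n = G v i n) -> F = G.
Proof. by move=> FG; do 3![apply/funext => ?]. Qed.

Lemma actD t F G : act t (fun v i n => F v i n + G v i n) =
  fun v i n => act t F v i n + act t G v i n.
Proof.
elim: t F G => [[w|e|e]||t IHt|t IHt u IHu|k t IHt|t IHt u IHu] F G;
  apply/gradedP => v i n /=.
- by case: eqP; rewrite ?addr0.
- by case: pop => [[e' i']|]; [case: eqP|]; rewrite ?addr0.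
- by case: eqP; rewrite ?addr0.
- by rewrite addr0.
- by rewrite IHt opprD.
- by rewrite IHt IHu addrACA.
- by rewrite IHt mulrDr.
- by rewrite IHu IHt.
Qed.

Lemma actZ t k F : act t (fun v i n => k * F v i n) =
  fun v i n => k * act t F v i n.
Proof.
elim: t F => [[w|e|e]||t IHt|t IHt u IHu|l t IHt|t IHt u IHu] F;
  apply/gradedP => v i n /=.
- by case: eqP; rewrite ?mulr0.
- by case: pop => [[e' i']|]; [case: eqP|]; rewrite ?mulr0.
- by case: eqP; rewrite ?mulr0.
- by rewrite mulr0.
- by rewrite IHt mulrN.
- by rewrite IHt IHu mulrDr.
- by rewrite IHt mulrCA.
- by rewrite IHu IHt.
Qed.

Lemma act_rel s t F : leavitt_rel s t -> act s F = act t F.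
Proof.
case=> {s t} [v w|e|e|e|e|e f|w rw]; apply/gradedP => u i n /=.
- by case: (altP (u =P v)) => [->|uv]; case: eqP => //= _;
    rewrite ?eqxx // (negPf uv).
- case: eqP => // ue; case Epop: pop => [[e' i']|] //.
  by case: eqP => // e'e; case: ue; rewrite -e'e; have [-> _] := popK Epop.
- by case: pop => [[e' i']|] //; rewrite eqxx.
- by case: eqP.
- by rewrite eqxx.
- rewrite pushK; case: (altP (e =P f)) => [<-|ef] /=; last by rewrite if_same.
  by rewrite addrK; case: eqP => [->|].
(* Each product [e e^*] acts as the projection to the places where [pop] returns the edge [e]. At a
   regular vertex exactly one edge is returned, so the projections add up to the identity there. *)
- have -> : forall (r : seq (edge E)), act (\big[@Add K _/Zero]_(e <- r)
      Mul (Gen (Edge e)) (Gen (Ghost e))) F u i n =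
      \sum_(e <- r) (if pop u i is Some (e', i') then
        if e' == e then F u i n else 0 else 0).
    elim=> [|e r IH]; first by rewrite !big_nil.
    rewrite !big_cons /= IH; congr (_ + _).
    case Epop: pop => [[e' i']|] //; case: eqP => // e'e.
    by have [<- <-] := popK Epop; rewrite eqxx e'e subrK.
  have [_ fw] := rw; have [uw|uw] := altP (u =P w); last first.
    rewrite big_seq big1 // => e; rewrite mem_outgoing // => /eqP ew.
    case Epop: pop => [[e' i']|] //; case: eqP => // e'e.
    by have [eu _] := popK Epop; rewrite -eu e'e ew eqxx in uw.
  rewrite uw; have [e [i' Epop]] := pop_regular i rw; rewrite Epop.
  have [se _] := popK Epop.
  rewrite (bigD1_seq e) ?fset_uniq //=; last first.
    by rewrite mem_outgoing // se.
  by rewrite eqxx big1 ?addr0 // => f; rewrite eq_sym => /negPf ->.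
Qed.

Lemma act_cong s t F : cong (@leavitt_rel K E) s t -> act s F = act t F.
Proof.
move=> st; elim: st F => {s t}.
- by move=> s t st F; apply: act_rel.
- by [].
- by move=> s t _ IH F.
- by move=> s t u _ IHst _ IHtu F; rewrite IHst.
- by move=> s t _ IH F; apply/gradedP => v i n /=; rewrite IH.
- by move=> s s' t t' _ IHs _ IHt F; apply/gradedP => v i n /=; rewrite IHs IHt.
- by move=> k s t _ IH F; apply/gradedP => v i n /=; rewrite IH.
- by move=> s s' t t' _ IHs _ IHt F; apply/gradedP => v i n /=; rewrite IHt IHs.
- by move=> r s t F; apply/gradedP => v i n /=; rewrite addrA.
- by move=> s t F; apply/gradedP => v i n /=; rewrite addrC.
- by move=> s F; apply/gradedP => v i n /=; rewrite add0r.
- by move=> s F; apply/gradedP => v i n /=; rewrite addNr.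
- by move=> k l s F; apply/gradedP => v i n /=; rewrite mulrA.
- by move=> s F; apply/gradedP => v i n /=; rewrite mul1r.
- by move=> k s t F; apply/gradedP => v i n /=; rewrite mulrDr.
- by move=> k l s F; apply/gradedP => v i n /=; rewrite mulrDl.
- by [].
- by [].
- by move=> r s t F; apply/gradedP => v i n /=; rewrite actD.
- by [].
- by move=> k s t F; apply/gradedP => v i n /=; rewrite actZ.
Qed.

(** * Elements of bounded degree *)

Definition supported F (n : int) := forall v i m, n < m -> F v i m = 0.

Definition shifts d t :=
  forall F n, supported F n -> supported (act t F) (n + d).

(** The action is defined on expressions, hence the choice of a representative; by [act_cong] the
    condition does not depend on it. *)
Definition of_degree_le d : set L :=
  [set x | exists2 t, x = quo t & shifts d t].

Lemma of_degree_le0 d : of_degree_le d 0.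
Proof. by exists Zero; rewrite ?quo0. Qed.

Lemma of_degree_leD d x y :
  of_degree_le d x -> of_degree_le d y -> of_degree_le d (x + y).
Proof.
move=> [s -> hs] [t -> ht]; exists (Add s t); rewrite ?quoD //.
by move=> F n Fn v i m nm /=; rewrite (hs F n) // (ht F n) // addr0.
Qed.

Lemma of_degree_leZ d k x : of_degree_le d x -> of_degree_le d (k *: x).
Proof.
move=> [s -> hs]; exists (Scale k s); rewrite ?quoZ //.
by move=> F n Fn v i m nm /=; rewrite (hs F n) // mulr0.
Qed.

Lemma of_degree_leB d x y :
  of_degree_le d x -> of_degree_le d y -> of_degree_le d (x - y).
Proof.
by move=> hx hy; rewrite -scaleN1r; apply/of_degree_leD/of_degree_leZ.
Qed.

Lemma of_degree_leM d d' x y :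
  of_degree_le d x -> of_degree_le d' y -> of_degree_le (d + d') (x ** y).
Proof.
move=> [s -> hs] [t -> ht]; exists (Mul s t); rewrite ?quoM //.
by move=> F n Fn /=; rewrite [d + d']addrC addrA; apply/hs/ht.
Qed.

Lemma of_degree_leW d d' : d <= d' -> of_degree_le d `<=` of_degree_le d'.
Proof.
move=> dd' _ [s -> hs]; exists s => // F n Fn v i m nm.
by apply: (hs F n) => //; apply: le_lt_trans nm; rewrite lerD2l.
Qed.

Lemma of_degree_le_vtx v : of_degree_le 0 (vtx v).
Proof.
exists (Gen (Vertex v)) => // F n Fn u i m nm /=.
by case: eqP => // _; rewrite Fn // -(addr0 n).
Qed.

Lemma of_degree_le_edg e : of_degree_le 1 (edg e).
Proof.
exists (Gen (Edge e)) => // F n Fn u i m nm /=.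
by case: pop => [[e' i']|] //; case: eqP => // _; rewrite Fn // ltrBrDr.
Qed.

Lemma of_degree_le_gst e : of_degree_le (- 1) (gst e).
Proof.
exists (Gen (Ghost e)) => // F n Fn u i m nm /=.
by case: eqP => // _; rewrite Fn // -ltrBlDr.
Qed.

Lemma of_degree_le_lspan d (B : set L) :
  B `<=` of_degree_le d -> forall x, lspan B x -> of_degree_le d x.
Proof.
move=> Bd x; elim=> [|k b y Bb _ IH]; first exact: of_degree_le0.
by apply/of_degree_leD => //; apply/of_degree_leZ/Bd.
Qed.

Lemma of_degree_le_rpath p w : of_degree_le (size p)%:Z (rpath p w).
Proof.
elim: p => [|e p IH] /=; first exact: of_degree_le_vtx.
by rewrite -add1n PoszD; apply: of_degree_leM => //; apply: of_degree_le_edg.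
Qed.

Lemma of_degree_le_gstpath p w : of_degree_le (- (size p)%:Z) (gstpath p w).
Proof.
elim: p => [|e p IH].
  by rewrite gstpath_nil oppr0; apply: of_degree_le_vtx.
rewrite gstpath_cons /= -addn1 PoszD opprD.
by apply: of_degree_leM => //; apply: of_degree_le_gst.
Qed.

Lemma vtx_degree v : ~ of_degree_le (- 1) (vtx v : L).
Proof.
move=> [t /quo_eqP vt ht].
(* The vertex [v] keeps the value 1 of this function in degree 0, whereas an element of degree at
   most -1 would send it to a function vanishing there. *)
pose F : graded := fun _ _ n => if n <= 0 then 1 else 0.
have F0 : supported F 0 by move=> u i m m0; rewrite /F leNgt m0.
have := ht F 0 F0 v (0%N, [::]) 0; rewrite -(act_cong F vt) /= eqxx /F lexx.
by move=> /(_ isT) /eqP; rewrite oner_eq0.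
Qed.

Lemma vtx_neq0 v : vtx v <> 0 :> L.
Proof.
by move=> v0; apply: (@vtx_degree v); rewrite v0; apply: of_degree_le0.
Qed.

Lemma scale_vtx_eq0 k v : k *: vtx v = 0 :> L -> k = 0.
Proof.
by move=> /eqP; rewrite scaler_eq0 => /orP[/eqP //|/eqP /vtx_neq0].
Qed.

End Filtration.

(** * Compression by long paths, and idempotents in the span of loops *)

Lemma gstpath_rpath_geq p w q w' : (size q <= size p)%N ->
  gstpath p w ** rpath q w' = 0 :> L \/
  exists r, gstpath p w ** rpath q w' = gstpath r w :> L.
Proof.
elim: q p => [|f q IH] p /=.
  have [[_ ->]|[_ ->]] := gstpath_vtx w' p w; last by left.
  by right; exists p.
case: p => [|e p] //= qp.
(* CK1 compares the first edges of [p] and [q]: a mismatch gives 0, and equal edges cancel, until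
   only a ghost path is left. *)
rewrite gstpath_cons -amulA (amulA (gst e)) gst_edg.
case: eqP => _; last by left; rewrite amul0l amul0r.
rewrite amulA; have [[_ ->]|[_ ->]] := gstpath_vtx (rng e) p w.
  exact: IH.
by left; rewrite amul0l.
Qed.

Lemma gstpath_rpath_leq p w q w' : (size p <= size q)%N ->
  gstpath p w ** rpath q w' = 0 :> L \/
  exists r, gstpath p w ** rpath q w' = rpath r w' :> L.
Proof.
move=> /(gstpath_rpath_geq w' w) [] h; [left|right].
  by rewrite -[LHS]starK starM starK h star0.
by have [r hr] := h; exists r; rewrite -[LHS]starK starM starK hr starK.
Qed.

Lemma gstpath_rpath_eq_size v p q w : gpath v p w -> size p = size q ->
  gstpath p w ** rpath q w = if p == q then vtx w else 0 :> L.
Proof.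
elim: p q v => [|e p IH] [|f q] v //=.
  by rewrite gstpath_nil vtxid.
move=> [_ gp] [pq].
rewrite gstpath_cons -amulA (amulA (gst e)) gst_edg eqseq_cons.
case: eqP => _ /=; last by rewrite amul0l amul0r.
by rewrite amulA (gstpath_vtx_id gp); exact: IH gp pq.
Qed.

Definition loops w : set L := [set x | exists2 p, gpath w p w & x = rpath p w].
Definition ghost_loops w : set L :=
  [set x | exists2 p, gpath w p w & x = gstpath p w].

Lemma lspan_gstpath_rpath p q w :
  lspan (loops w `|` ghost_loops w) (gstpath p w ** rpath q w).
Proof.
rewrite -(rpath_vtx q) amulA.
have [/gstpath_rpath_geq|/ltnW/gstpath_rpath_leq] := leqP (size q) (size p).
  case/(_ w w) => [->|[r ->]]; first by rewrite amul0l; apply: lspan0.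
  have [[gr ->]|[_ ->]] := gstpath_vtx w r w; last exact: lspan0.
  by apply: lspan_gen; right; exists r.
case/(_ w w) => pq; rewrite -(vtx_gstpath p) -!amulA (amulA (gstpath _ _)).
  by rewrite pq amul0l amul0r; apply: lspan0.
have [r ->] := pq; rewrite rpath_vtx.
have [[gr ->]|[_ ->]] := vtx_rpath w r w; last exact: lspan0.
by apply: lspan_gen; left; exists r.
Qed.

(** Take [n] to be the maximal length of the paths in the monomials [q r^*] of [x]. For longer [p],
    [p^* q] is 0 or a ghost path and [r^* p] is 0 or a real path; their product reduces again to a
    single path or ghost path. *)
Lemma lspan_compress x : exists n, forall p w, (n <= size p)%N ->
  lspan (loops w `|` ghost_loops w) (gstpath p w ** x ** rpath p w).
Proof.
elim: (span_monos x) => [|k _ y [q [r [u ->]]] _ [n IH]].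
  by exists 0%N => p w _; rewrite amul0r amul0l; apply: lspan0.
exists (maxn n (maxn (size q) (size r))) => p w.
rewrite !geq_max => /and3P[np qp rp].
rewrite amulDr amulDl; apply: lspanD (IH p w np).
rewrite amulZr amulZl; apply: lspanZ; rewrite /mono amulA -amulA.
have [->|[q' ->]] := gstpath_rpath_geq w u qp.
  by rewrite amul0l; apply: lspan0.
have [->|[r' ->]] := gstpath_rpath_leq u w rp.
  by rewrite amul0r; apply: lspan0.
exact: lspan_gstpath_rpath.
Qed.

(** Collecting terms so that each path occurs once makes it possible to extract a coefficient by
    multiplying with a ghost path. *)
Lemma lspan_rpath_coef w (P : set (seq (edge E))) x :
  lspan [set y | exists2 p, P p & y = rpath p w] x ->
  exists (s : seq (seq (edge E))) (c : seq (edge E) -> K),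
    [/\ uniq s, forall p, p \in s -> P p & x = \sum_(p <- s) c p *: rpath p w].
Proof.
elim=> [|k _ y [p Pp ->] _ [s [c [Us sP ->]]]].
  by exists [::], (fun=> 0); split; rewrite ?big_nil.
(* The values of [c] outside [s] are arbitrary, so for a new path the old coefficient has to be
   replaced by 0. *)
pose c' q := if q == p then k + (if p \in s then c p else 0) else c q.
have [ps|ps] := boolP (p \in s).
  exists s, c'; split=> //; rewrite !(bigD1_seq p) //= addrA -scalerDl.
  rewrite /c' eqxx ps; congr (_ + _).
  by apply: eq_bigr => q /negPf ->.
exists (p :: s), c'; split=> [|q|]; first by rewrite /= ps.
  by rewrite inE => /predU1P[->|/sP].
rewrite big_cons /c' eqxx (negPf ps) addr0; congr (_ + _).
apply: eq_big_seq => q qs; case: eqP => // qp.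
by rewrite -qp qs in ps.
Qed.

(* If c is the coefficient in z of a real loop p of maximal length N > 0, then
   (pp)^* z^2 is c^2 w up to terms of negative degree, whereas (pp)^* z has
   negative degree. *)
Lemma idempotent_strip_loops w (Q : set (seq (edge E))) z : z ** z = z ->
  lspan (loops w `|` [set x | exists2 q, Q q & x = gstpath q w]) z ->
  lspan ([set vtx w] `|` [set x | exists2 q, Q q & x = gstpath q w]) z.
Proof.
move=> zz; set G := [set x | _].
(* Longest loops are stripped first: [N] bounds the lengths of the real loops in [z], and at 0 only
   [w] remains. *)
pose R N : set L :=
  [set x | exists2 p, gpath w p w /\ (size p <= N)%N & x = rpath p w].
have RS M N : (M <= N)%N -> R M `<=` R N.
  by move=> MN _ [p [gp pM] ->]; exists p; rewrite ?(leq_trans pM).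
move=> spz; have [N {spz}] : exists N, lspan (R N `|` G) z.
  elim: spz => [|k b y Bb _ [N IH]]; first by exists 0%N; apply: lspan0.
  case: Bb => [[p gp ->]|Gb]; last first.
    by exists N; apply: lspan_cons => //; right.
  exists (maxn (size p) N); apply: lspan_cons.
    by left; exists p; rewrite ?leq_maxl.
  by apply: lspanS IH => a [/(RS _ _ (leq_maxr _ _))|]; [left|right].
elim: N => [|N IH] spz.
  apply: lspanS spz => a [[p []]|]; [|by right].
  by case: p => // _ _ ->; left.
have {spz}: lspan ([set x | exists2 p, gpath w p w /\ size p = N.+1 &
    x = rpath p w] `|` (R N `|` G)) z.
  apply: lspanS spz => a [[p [gp]]|]; last by right; right.
  rewrite leq_eqVlt => /orP[/eqP pN|pN] ->; first by left; exists p.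
  by right; left; exists p.
move=> /lspanU[a [b [sa sb zab]]].
have [s [c [Us sP aE]]] := lspan_rpath_coef sa.
have degb : of_degree_le N%:Z b.
  apply: of_degree_le_lspan sb => _ [[p [_ pN] ->]|[q _ ->]].
    by apply: of_degree_leW (of_degree_le_rpath p w); rewrite lez_nat.
  by apply: of_degree_leW (of_degree_le_gstpath q w); rewrite lerNl; lia.
have dega : of_degree_le N.+1%:Z a.
  apply: of_degree_le_lspan sa => _ [p [_ pN] ->].
  by rewrite -pN; apply: of_degree_le_rpath.
suff a0 : a = 0 by apply: IH; rewrite zab a0 add0r.
rewrite aE big_seq big1 // => p ps; have [gp pN] := sP p ps.
suff -> : c p = 0 by rewrite scale0r.
set g : L := gstpath p w.
have degg : of_degree_le (- N.+1%:Z) g.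
  by rewrite -pN; apply: of_degree_le_gstpath.
have ga : g ** a = c p *: vtx w.
  rewrite aE amul_sumr (bigD1_seq p) //= amulZr.
  rewrite (gstpath_rpath_eq_size gp) // eqxx big_seq_cond big1 ?addr0 // => q.
  move=> /andP[qs qp]; rewrite amulZr (gstpath_rpath_eq_size gp) ?pN.
    by rewrite eq_sym (negPf qp) scaler0.
  by have [_ ->] := sP q qs.
have ggaa : g ** g ** (a ** a) = (c p * c p) *: vtx w.
  rewrite -amulA (amulA g a) ga amulZl amulZr amulA (gstpath_vtx_id gp) ga.
  by rewrite scalerA.
have : of_degree_le (- 1) ((c p * c p) *: vtx w : L).
  (* Here [z = z^2 = a^2 + ab + bz]. The element [gg] has degree at most -2(N+1), while [z] and
     [ab + bz] have degree at most 2N+1. *)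
  have -> : (c p * c p) *: vtx w =
      g ** g ** z - g ** g ** (a ** b + b ** z) :> L.
    rewrite -ggaa -amulBr; congr (_ ** _); apply: (canRL (addrK _)).
    by rewrite addrA -amulDr -zab -amulDl -zab zz.
  have degz : of_degree_le N.+1%:Z z.
    by rewrite zab; apply: of_degree_leD => //; apply: of_degree_leW degb; lia.
  have deggg := of_degree_leM degg degg.
  apply: of_degree_leB.
    by apply: of_degree_leW (of_degree_leM deggg degz); lia.
  have degab := of_degree_leM dega degb; have degbz := of_degree_leM degb degz.
  rewrite [N.+1%:Z + _]addrC in degab.
  apply: of_degree_leW (of_degree_leM deggg (of_degree_leD degab degbz)); lia.
move=> /(of_degree_leZ (c p * c p)^-1); rewrite scalerA.
have [->//|cp] := eqVneq (c p) 0.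
by rewrite mulVf ?mulf_neq0 // scale1r => /vtx_degree.
Qed.

(** Real loops are stripped first. The involution then turns the ghost loops into real ones, and a
    second stripping, with the empty path as only ghost, leaves multiples of [w]. *)
Lemma idempotent_scalar w z : z ** z = z ->
  lspan (loops w `|` ghost_loops w) z -> exists k, z = k *: vtx w.
Proof.
move=> zz /(idempotent_strip_loops zz) spz.
have {}spz : lspan ([set vtx w] `|`
    [set x | exists2 q, q = [::] & x = gstpath q w]) (star z).
  apply: idempotent_strip_loops; first by rewrite -starM zz.
  apply: (lspan_morph starD starZ) spz => _ [->|[q gq ->]]; apply: lspan_gen.
    by right; exists [::]; rewrite // gstpath_nil star_vtx.
  by left; exists q; rewrite // /gstpath starK.
suff [k zk] : exists k, star z = k *: vtx w.
  by exists k; rewrite -[z]starK zk starZ star_vtx.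
elim: spz => [|k b y Bb _ [l ->]]; first by exists 0; rewrite scale0r.
exists (k + l); rewrite scalerDl; congr (k *: _ + _).
by case: Bb => [|[q ->]] ->; rewrite ?gstpath_nil.
Qed.

Lemma idempotent_scalar01 w (k : K) :
  (k *: vtx w) ** (k *: vtx w) = k *: vtx w :> L -> k = 0 \/ k = 1.
Proof.
rewrite amulZl amulZr vtxid scalerA => /eqP.
rewrite -subr_eq0 -scalerBl => /eqP/scale_vtx_eq0/eqP.
rewrite -{3}[k]mulr1 -mulrBr mulf_eq0 subr_eq0.
by move=> /orP[]/eqP; [left|right].
Qed.

(** * Compatible paths *)

Section Paths.
Implicit Types (H : set (vertex E)).

Lemma gpath_rcons v q e w :
  gpath v (rcons q e) w <-> gpath v q (src e) /\ rng e = w.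
Proof.
elim: q v => [|f q IH] v /=; first by split=> -[-> ->].
by split=> [[-> /IH[]]|[[-> gq] ew]] //; split=> //; apply/IH.
Qed.

Lemma compatible_cons H e p :
  compatible_from H (rng e) p -> compatible_from H (src e) (e :: p).
Proof. by move=> [q [f [w [-> gq Hw Hf]]]]; exists (e :: q), f, w. Qed.

Lemma compatible_edge H e : H (rng e) -> ~ (H `|` breaking H) (src e) ->
  compatible_from H (src e) [:: e].
Proof. by move=> He Hs; exists [::], e, (rng e). Qed.

Lemma compatible_inv H v p : compatible_from H v p ->
  exists2 e, src e = v & (p = [:: e] /\ H (rng e)
      /\ ~ (H `|` breaking H) v) \/
    exists2 q, p = e :: q & compatible_from H (rng e) q.
Proof.
move=> [[|f q] [e [w [-> /= [sv gq] Hw He]]]].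
  by exists e => //; left; rewrite gq -sv.
by exists f => //; right; exists (rcons q e) => //; exists q, e, w.
Qed.

Lemma disjoint_absurd H H' v : H `&` H' = set0 -> H v -> H' v -> False.
Proof. by move=> HH' Hv H'v; have : set0 v by rewrite -HH'. Qed.

(** Heredity would carry membership in [H'] along the path: to the source of its last edge,
    impossible if [H = H'], and to its end in [H], impossible if the sets are disjoint. *)
Lemma compatible_notin H H' v p : hereditary H' ->
  (H `&` H' = set0 \/ H = H') -> compatible_from H v p -> ~ H' v.
Proof.
move=> hH' HH' [q [e [w [-> /gpath_rcons[gq ew] Hw He]]]] /hH' /(_ gq) H'e.
case: HH' => [HH'|HH']; last by apply: He; left; rewrite HH'.
apply: (disjoint_absurd HH' Hw); rewrite -ew.
exact: (hH' _ [:: e] _ H'e (conj erefl erefl)).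
Qed.

(** All edges out of a vertex of [H], and all but finitely many out of a breaking vertex, end in
    [H]. An infinite emitter cannot behave so for two disjoint sets. *)
Lemma breaking_disjoint H1 H2 v : hereditary H1 -> hereditary H2 ->
  H1 `&` H2 = set0 ->
  (H1 `|` breaking H1) v -> (H2 `|` breaking H2) v -> False.
Proof.
move=> h1 h2 H12.
have inf H H' : hereditary H -> H `&` H' = set0 -> H v -> ~ breaking H' v.
  move=> hH HH' Hv [_ iv _ fv]; apply: iv; apply: sub_finite_set fv => e ev.
  split=> //; apply: (disjoint_absurd HH').
  exact: (hH v [:: e] _ Hv (conj ev erefl)).
move=> [v1|b1] [v2|b2].
- exact: (disjoint_absurd H12 v1 v2).
- exact: (inf _ _ h1 H12 v1 b2).
- by apply: (inf _ _ h2 _ v2 b1); rewrite setIC.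
- case: b1 b2 => [_ iv _ f1] [_ _ _ f2]; apply: iv.
  have /sub_finite_set : emitted v `<=` (emitted v `&` (@rng E @^-1` ~` H1)) `|`
    (emitted v `&` (@rng E @^-1` ~` H2)).
    move=> e ev; have [e1|e1] := pselect (H1 (rng e)); last by left.
    by right; split=> //; apply: (disjoint_absurd H12 e1).
  by apply; rewrite finite_setU.
Qed.

(** Induction on [n]: an edge out of [v] that ends outside both sets leads to a vertex with a
    smaller bound. The sets are shown nonempty along the way, since an edge not ending in one of
    them ends in the other or outside both. *)
Lemma compatible_exists H1 H2 v n :
  hereditary H1 -> hereditary H2 -> H1 `&` H2 = set0 ->
  (forall u, infinite_emitter u ->
    finite_set (emitted u `&` (@rng E @^-1` ~` H1)) \/
    finite_set (emitted u `&` (@rng E @^-1` ~` H2))) ->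
  (forall u, ~ (H1 `|` H2) u ->
    emitted u `&` (@rng E @^-1` ~` H1) !=set0 /\
    emitted u `&` (@rng E @^-1` ~` H2) !=set0) ->
  (forall p w, gpath v p w -> (n <= size p)%N -> (H1 `|` H2) w) ->
  ~ (H1 `|` H2) v ->
  [/\ H1 !=set0, H2 !=set0,
      compatible_from H1 v `|` compatible_from H2 v !=set0 &
      finite_set (compatible_from H1 v `|` compatible_from H2 v)].
Proof.
move=> h1 h2 H12 almost out; elim: n v => [|n IH] v bound Gv.
  by case: Gv; apply: (bound [::]).
have disj u : H1 u -> H2 u -> False.
  by move=> u1; apply: (disjoint_absurd H12 u1).
have IHe e : src e = v -> ~ (H1 `|` H2) (rng e) ->
  [/\ H1 !=set0, H2 !=set0,
      compatible_from H1 (rng e) `|` compatible_from H2 (rng e) !=set0 &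
      finite_set (compatible_from H1 (rng e) `|` compatible_from H2 (rng e))].
  move=> ev; apply: IH => p w gp np; exact: (bound (e :: p) w (conj ev gp)).
have [nH1v nH2v] : ~ H1 v /\ ~ H2 v by split=> ?; apply: Gv; [left|right].
have [[e1 [ev1 e1H]] [e2 [ev2 e2H]]] := out v Gv.
split.
- have [e2H2|] := pselect ((H1 `|` H2) (rng e2)).
    by case: e2H2 => // ?; exists (rng e2).
  by case/(IHe _ ev2).
- have [e1H2|] := pselect ((H1 `|` H2) (rng e1)).
    by case: e1H2 => // ?; exists (rng e1).
  by case/(IHe _ ev1).
- have go e : src e = v -> ~ (H1 `|` H2) (rng e) ->
      compatible_from H1 v `|` compatible_from H2 v !=set0.
    move=> ev /(IHe _ ev)[_ _ [p cp] _]; exists (e :: p); rewrite -ev.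
    by case: cp => /compatible_cons; [left|right].
  (* If [e1] ends in [H2], it is itself a compatible path unless [v] is breaking for [H2]. In that
     case [v] is not breaking for [H1], and [e2] serves instead. *)
  have [e1H2|/(go _ ev1) //] := pselect ((H1 `|` H2) (rng e1)).
  case: e1H2 => // e1H2; have [b2|nb2] := pselect (breaking H2 v); last first.
    by exists [:: e1]; right; rewrite -ev1; apply: compatible_edge;
       rewrite // ev1 => -[].
  have [_ iv _ _] := b2; have [e2H1|/(go _ ev2) //] :=
    pselect ((H1 `|` H2) (rng e2)).
  case: e2H1 => // e2H1; exists [:: e2]; left; rewrite -ev2.
  apply: compatible_edge; rewrite // ev2 => b1.
  by apply: (breaking_disjoint h1 h2 H12 b1); right.
(* A compatible path is a single edge from [edges], or an edge from [inner] followed by a shorter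
   compatible path. If almost all of infinitely many edges end in [H1], then [v] is breaking for
   [H1], so [edges H1] is empty and the other two sets are finite; likewise for [H2]. *)
- pose edges H := [set e | [/\ src e = v, H (rng e) & ~ breaking H v]].
  pose inner := emitted v `&` [set e | ~ (H1 `|` H2) (rng e)].
  have fin :
      [/\ finite_set (edges H1), finite_set (edges H2) & finite_set inner].
    have [iv|/contrapT fv] := pselect (infinite_emitter v); last first.
      by split; apply: sub_finite_set fv => e; [case|case|case].
    have [f1|f2] := almost v iv.
      split; last 1 first.
      - apply: sub_finite_set f1 => e [ev eG]; split=> // eH.
        by apply: eG; left.
      - have b1 : breaking H1 v by split=> //; exists e1.
        by rewrite [edges H1](_ : _ = set0) // -subset0 => e [].
      - apply: sub_finite_set f1 => e [ev eH _]; split=> // eH1.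
        exact: disj eH.
    split; last 1 first.
    - apply: sub_finite_set f2 => e [ev eG]; split=> // eH.
      by apply: eG; right.
    - by apply: sub_finite_set f2 => e [ev eH _]; split=> // /(disj _ eH).
    - have b2 : breaking H2 v by split=> //; exists e2.
      by rewrite [edges H2](_ : _ = set0) // -subset0 => e [].
  have [fin1 fin2 fin3] := fin.
  have sub : compatible_from H1 v `|` compatible_from H2 v `<=`
    ((fun e => [:: e]) @` edges H1 `|` (fun e => [:: e]) @` edges H2) `|`
    \bigcup_(e in inner) (cons e @`
      (compatible_from H1 (rng e) `|` compatible_from H2 (rng e))).
    move=> p [] /compatible_inv[e ev [[-> [eH bv]]|[q -> cq]]].
    - left; left; exists e => //; split=> // b; apply: bv; by right.
    - right; exists e; last by exists q => //; left.
      split=> // -[]; first exact: (compatible_notin h1 (or_intror erefl) cq).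
      exact: (compatible_notin h2 (or_introl H12) cq).
    - left; right; exists e => //; split=> // b; apply: bv; by right.
    - right; exists e; last by exists q => //; right.
      split=> // -[]; last exact: (compatible_notin h2 (or_intror erefl) cq).
      by apply: (compatible_notin h1 _ cq); left; rewrite setIC.
  apply: sub_finite_set sub _; rewrite !finite_setU; split; first split.
  + exact: finite_image.
  + exact: finite_image.
  + apply: bigcup_finite => // e [ev eG]; apply: finite_image.
    by have [] := IHe e ev eG.
Qed.

End Paths.

(** * Direct sums of ideals *)

(** A path [p] from [v] to [w] satisfies [p^* v p = w]. *)
Lemma ideal_hereditary (T : set L) :
  two_sided_ideal T -> hereditary [set v | T (vtx v)].
Proof.
move=> [_ _ _ TM] v p w /= Tv gp.
have /= := gstpath_rpath_eq_size gp (erefl (size p)); rewrite eqxx => <-.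
by rewrite -(vtx_rpath_id gp) amulA; apply: (TM _ _ _).2; apply: (TM _ _ _).1.
Qed.

Lemma ideal_edges (T : set L) (s : seq (edge E)) : two_sided_ideal T ->
  (forall e, e \in s -> T (vtx (rng e))) ->
  T (\sum_(e <- s) edg e ** gst e).
Proof.
move=> idT sT; apply: ideal_sum => // e /sT Te; have [_ _ _ TM] := idT.
by rewrite -edg_rng; apply: (TM _ _ _).2; apply: (TM _ _ _).1.
Qed.

Lemma ideal_saturated (T : set L) :
  two_sided_ideal T -> saturated [set v | T (vtx v)].
Proof.
move=> idT v rv vT; have [_ fv] := rv.
rewrite /= (vtx_regular rv); apply: ideal_edges => // e.
by rewrite mem_outgoing // => /eqP ev; apply: vT; exists e.
Qed.

Lemma infinite_emitter_edge v (s : seq (edge E)) :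
  infinite_emitter v -> exists2 e, src e = v & e \notin s.
Proof.
move=> iv; apply: contrapT => nex; apply: iv.
apply: sub_finite_set (finite_seq s) => e ev.
by apply: contrapT => /negP es; apply: nex; exists e.
Qed.

Section Decomposition.
Context (I J : set L) (idI : two_sided_ideal I) (idJ : two_sided_ideal J).
Context (dIJ : direct_sum I J).

Lemma ideal_inter0 x : I x -> J x -> x = 0.
Proof.
by move=> Ix Jx; have [IJ _] := dIJ; rewrite -[_ = _]/([set 0] x) -IJ.
Qed.

(** The difference [z - z^2 = z(w - z)] lies in both ideals. *)
Lemma component_idempotent w z :
  I z -> J (vtx w - z) -> z ** vtx w = z -> z ** z = z.
Proof.
have [_ _ _ IM] := idI; have [_ _ _ JM] := idJ.
move=> Iz Jz zw; apply/esym/subr0_eq.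
rewrite -[X in X - _]zw -amulBr; apply: ideal_inter0.
  exact: (IM _ _ _).2.
exact: (JM _ _ _).1.
Qed.

Lemma vertex_component v :
  exists x, [/\ I x, J (vtx v - x) & vtx v ** x ** vtx v = x].
Proof.
have [_ _ _ IM] := idI; have [_ _ _ JM] := idJ.
have [_ /(_ (vtx v))[x [y [Ix Jy vE]]]] := dIJ.
(* Cutting by [v] on both sides keeps the components in their ideals and moves [x] into the corner,
   where [span_corner] applies. *)
exists (vtx v ** x ** vtx v); split.
- by apply: (IM _ _ _).2; apply: (IM _ _ _).1.
- have -> : vtx v - vtx v ** x ** vtx v = vtx v ** y ** vtx v.
    by rewrite -[y](addKr x) (addrC (- x)) -vE amulBr amulBl !vtxid.
  by apply: (JM _ _ _).2; apply: (JM _ _ _).1.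
- by rewrite !amulA vtxid -!amulA vtxid.
Qed.

Lemma component_scalar v w x k : I x -> J (vtx w - x) -> x = k *: vtx w ->
  I (vtx w) \/ J (vtx w).
Proof.
move=> Ix Jx xk; have xx : x ** x = x.
  by apply: component_idempotent Jx _; rewrite // xk amulZl vtxid.
move: xx Ix Jx; rewrite xk => /idempotent_scalar01[] ->.
  by rewrite scale0r subr0; right.
by rewrite scale1r; left.
Qed.

Lemma long_paths v : exists n, forall p w, gpath v p w ->
  (n <= size p)%N -> I (vtx w) \/ J (vtx w).
Proof.
have [_ _ _ IM] := idI; have [_ _ _ JM] := idJ.
have [x [Ix Jx vxv]] := vertex_component v; have [n spx] := lspan_compress x.
exists n => p w gp np; have {spx} := spx p w np.
(* Since [p^* v p = w], this is the component of [w] in [I]. *)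
set z := _ ** _ => spz.
have Iz : I z by apply: (IM _ _ _).2; apply: (IM _ _ _).1.
have Jz : J (vtx w - z).
  have -> : vtx w - z = gstpath p w ** (vtx v - x) ** rpath p w.
    rewrite amulBr amulBl -(amulA _ (vtx v)) (vtx_rpath_id gp).
    by rewrite (gstpath_rpath_eq_size gp) // eqxx.
  by apply: (JM _ _ _).2; apply: (JM _ _ _).1.
have zw : z ** vtx w = z by rewrite /z -amulA rpath_vtx.
have [k zk] := idempotent_scalar (component_idempotent Iz Jz zw) spz.
exact: component_scalar zk.
Qed.

Lemma almost_all_edges v : infinite_emitter v ->
  finite_set (emitted v `&` (@rng E @^-1` ~` [set w | I (vtx w)])) \/
  finite_set (emitted v `&` (@rng E @^-1` ~` [set w | J (vtx w)])).
Proof.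
move=> iv; have [_ _ _ IM] := idI; have [_ _ _ JM] := idJ.
have [x [Ix Jx vxv]] := vertex_component v.
(* The scalar [k] is the coefficient of [v] in [x], and [s] collects first edges of the nontrivial
   paths in its monomials; [e^*] or [e] kills those monomials when [e] is not in [s]. *)
have [k [s xs]] : exists k (s : seq (edge E)), forall e, src e = v ->
    e \notin s -> gst e ** x ** edg e = k *: vtx (rng e).
  elim: (span_corner vxv) => [|k _ y [p [q [w [gp gq ->]]]] _ [l [s sy]]].
    by exists 0, [::] => e _ _; rewrite amul0r amul0l scale0r.
  case: p gp => [/= vw|f p _]; last first.
    exists l, (f :: s) => e ev; rewrite inE negb_or => /andP[ef es].
    rewrite amulDr amulDl sy // amulZr /mono /= !amulA gst_edg (negPf ef).
    by rewrite !amul0l scaler0 amul0l add0r.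
  case: q gq => [_|f q _].
    exists (k + l), s => e ev es.
    rewrite amulDr amulDl sy // /mono gstpath_nil /= -vw vtxid.
    rewrite amulZr gst_vtx ev eqxx amulZl gst_edg eqxx.
    by rewrite -scalerDl.
  exists l, (f :: s) => e ev; rewrite inE negb_or => /andP[ef es].
  rewrite amulDr amulDl sy // amulZr amulZl /mono gstpath_cons -!amulA gst_edg.
  by rewrite eq_sym (negPf ef) !amul0r scaler0 add0r.
have comp e : src e = v -> e \notin s ->
    I (k *: vtx (rng e)) /\ J (vtx (rng e) - k *: vtx (rng e)).
  move=> ev es; rewrite -xs //; split.
    by apply: (IM _ _ _).2; apply: (IM _ _ _).1.
  have -> : vtx (rng e) = gst e ** vtx v ** edg e.
    by rewrite gst_vtx ev eqxx gst_edg eqxx.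
  by rewrite -amulBl -amulBr; apply: (JM _ _ _).2; apply: (JM _ _ _).1.
have fins : finite_set [set` s] by exact: finite_seq.
(* One edge outside [s] forces [k] to be 0 or 1, and this value decides for all the other edges
   outside [s]. *)
have [e ev es] := infinite_emitter_edge s iv.
have [Ie Je] := comp e ev es.
have := component_idempotent Ie Je; rewrite amulZl vtxid => /(_ erefl).
case/idempotent_scalar01 => k01; [right|left]; apply: sub_finite_set fins;
  move=> f [fv nf]; apply: contrapT => /negP fs; apply: nf.
  by have [_] := comp f fv fs; rewrite k01 scale0r subr0.
by have [+ _] := comp f fv fs; rewrite k01 scale1r.
Qed.

(** Only the empty path starts at a sink, so its corner consists of the multiples of [v]. *)
Lemma sink_component v : sink v -> I (vtx v) \/ J (vtx v).
Proof.
move=> sv; have [x [Ix Jx vxv]] := vertex_component v.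
have [k xk] : exists k, x = k *: vtx v; last exact: component_scalar xk.
have nil p w : gpath v p w -> p = [::].
  by case: p => // e p [ev _]; have : emitted v e by []; rewrite sv.
elim: (span_corner vxv) => [|k _ y [p [q [w [gp gq ->]]]] _ [l ->]].
  by exists 0; rewrite scale0r.
have p0 := nil _ _ gp; move: gp; rewrite p0 (nil _ _ gq) /= => <-.
by exists (k + l); rewrite /mono gstpath_nil vtxid scalerDl.
Qed.

(* If every edge leaving v ends in I and v is not in I, then no closed path
   passes through v, so the component y of v in J satisfies y^2 = k y, where k
   is the coefficient of v in y; and e^* y = 0 = k e^* for all but finitely
   many edges e leaving v. *)
Lemma infinite_emitter_component v : infinite_emitter v ->
  (forall e, src e = v -> I (vtx (rng e))) -> I (vtx v).
Proof.
move=> iv vI; have [_ _ _ IM] := idI; have [_ _ _ JM] := idJ.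
apply: contrapT => nIv.
have [x [Ix Jy vxv]] := vertex_component v; set y := vtx v - x in Jy.
have vyv : vtx v ** y ** vtx v = y.
  by rewrite /y amulBr amulBl vxv !vtxid.
have yy : y ** y = y.
  have xv : x ** vtx v = x by rewrite -vxv -amulA vtxid.
  have vx : vtx v ** x = x by rewrite -vxv !amulA vtxid.
  have xx := component_idempotent Ix Jy xv.
  by rewrite /y amulBl !amulBr vtxid vx xv xx subrr subr0.
have ye e : src e = v -> y ** edg e = 0.
  move=> ev; apply: ideal_inter0; last exact: (JM _ _ _).2.
  by rewrite -edg_rng amulA; apply: (IM _ _ _).1; apply: vI.
have ey e : src e = v -> gst e ** y = 0.
  move=> ev; apply: ideal_inter0; last exact: (JM _ _ _).1.
  by rewrite -rng_gst -amulA; apply: (IM _ _ _).2; apply: vI.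
have span_y t : lspan (corner_monos v) t ->
    exists k (s : seq (edge E)), y ** t = k *: y /\
    forall e, src e = v -> e \notin s -> gst e ** t = k *: gst e.
  elim=> [|k _ u [p [q [w [gp gq ->]]]] _ [l [s [tk et]]]].
    exists 0, [::]; rewrite amul0r scale0r; split=> // e _ _.
    by rewrite amul0r scale0r.
  case: p gp => [/= vw|f p [/= fv _]]; last first.
    exists l, (f :: s); split=> [|e ev].
      by rewrite amulDr amulZr /mono /= !amulA ye // !amul0l scaler0 add0r.
    rewrite inE negb_or => /andP[ef es]; rewrite amulDr et // amulZr /mono /=.
    by rewrite !amulA gst_edg (negPf ef) !amul0l scaler0 add0r.
  (* Now [w = v], so a nonempty [q] is a closed path at [v] whose first edge ends in [I]; heredity
     would put [v] in [I]. *)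
  case: q gq => [_|f q [fv gq]]; last first.
    by case: nIv; rewrite vw; exact: (ideal_hereditary idI (vI f fv) gq).
  have yv : y ** vtx v = y by rewrite -vyv -amulA vtxid.
  exists (k + l), s; rewrite /mono gstpath_nil /= -vw vtxid; split=> [|e ev es].
    by rewrite amulDr amulZr yv tk scalerDl.
  by rewrite amulDr amulZr gst_vtx ev eqxx et // scalerDl.
have [k [s [yk eyk]]] := span_y _ (span_corner vyv).
have [e ev es] := infinite_emitter_edge s iv.
have k0 : k = 0.
  have /(congr1 (fun z => z ** edg e)) := eyk e ev es.
  by rewrite ey // amul0l amulZl gst_edg eqxx => /esym/scale_vtx_eq0.
apply: nIv; suff <- : x = vtx v by [].
by apply/esym/subr0_eq; rewrite -/y -yy yk k0 scale0r.
Qed.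

(** Suppose all edges out of [v] end in [I]. A sink lies in [I] or [J], an infinite emitter lies in
    [I] by the previous lemma, and a regular vertex does by saturation. *)
Lemma escaping_edge v : ~ I (vtx v) -> ~ J (vtx v) ->
  emitted v `&` (@rng E @^-1` ~` [set w | I (vtx w)]) !=set0.
Proof.
move=> nI nJ; apply: contrapT => ne.
have vI e : src e = v -> I (vtx (rng e)).
  by move=> ev; apply: contrapT => nIe; apply: ne; exists e.
have [sv|nsv] := pselect (sink v); first by case: (sink_component sv).
have [iv|niv] := pselect (infinite_emitter v).
  by apply/nI/infinite_emitter_component.
apply: nI; apply: (ideal_saturated idI) => // _ [e ev <-]; exact: vI.
Qed.

Lemma ideal_component_neq0 : I <> [set 0] ->
  exists v, ~ J (vtx v).
Proof.
move=> nI0; apply: contrapT => allJ; apply: nI0; apply/seteqP; split=> x /=.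
  move=> Ix; have [_ _ _ IM] := idI; have [_ _ _ JM] := idJ.
  have [s ->] := sum_vtx x; apply: big1 => v _; apply: ideal_inter0.
    exact: (IM _ _ _).2.
  by apply: (JM _ _ _).1; apply: contrapT => nJ; apply: allJ; exists v.
by move=> ->; have [] := idI.
Qed.

End Decomposition.

(** * Ideals built from disjoint hereditary sets *)

Section SumOfIdeals.
Implicit Types (H : set (vertex E)).

(* For v in B_H this is the element usually written v^H. *)
Definition ideal_gen H v : L :=
  if `[< H v >] then vtx v else
  vtx v -
    \sum_(e <- fset_set (emitted v `&` (@rng E @^-1` ~` H))) edg e ** gst e.

Lemma star_ideal_gen H v : star (ideal_gen H v) = ideal_gen H v.
Proof.
rewrite /ideal_gen; case: asboolP => _; first exact: star_vtx.
rewrite starD starN star_vtx (big_morph star starD star0); congr (_ - _).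
by apply: eq_bigr => e _; rewrite starM star_edg star_gst.
Qed.

(** For [v] breaking and [e] an edge out of [v] not ending in [H], the subtracted term [e e^* e = e]
    cancels [v e]. A first edge ending in [H] forces the whole path to end there. *)
Lemma ideal_gen_rpath H v p w : hereditary H -> (H `|` breaking H) v ->
  ideal_gen H v ** rpath p w = 0 \/ (H `|` breaking H) w.
Proof.
move=> hH Hv; rewrite /ideal_gen; case: asboolP => [vH|nvH].
  have [[gp _]|[_ ->]] := vtx_rpath v p w; last by left.
  by right; left; apply: hH gp.
have [//|[_ iv _ fv]] := Hv; case: p => [|e p] /=.
  have [<-|vw] := eqVneq v w; [by right|left].
  rewrite amulBl vtxM (negPf vw) sub0r amul_suml big_seq big1 ?oppr0 // => e.
  rewrite in_fset_set // inE => -[/= ev _].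
  by rewrite -amulA gst_vtx ev (negPf vw) amul0r.
rewrite -(edg_rng e) -!amulA.
have [[gp ->]|[_ ->]] := vtx_rpath (rng e) p w; last by left; rewrite !amul0r.
have [eH|neH] := pselect (H (rng e)); [by right; left; apply: hH gp|left].
rewrite amulA amulBl vtx_edg amul_suml.
have sume f : edg f ** gst f ** edg e = if f == e then edg e else 0.
  rewrite -amulA gst_edg; case: eqP => [->|_]; last by rewrite amul0r.
  by rewrite edg_rng.
case: eqP => ev; last first.
  rewrite big_seq big1 ?subr0 ?amul0l // => f.
  rewrite in_fset_set // inE => -[sf _]; rewrite sume; case: eqP => // fe.
  by case: ev; rewrite -fe.
rewrite (bigD1_seq e) ?fset_uniq //=; last by rewrite in_fset_set // inE; split.
rewrite sume eqxx big1 ?addr0 ?subrr ?amul0l // => f fe.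
by rewrite sume (negPf fe).
Qed.

(** In a monomial [p q^*] of [x], a nonzero product on the left puts the common end of [p] and [q]
    in [H1] or its breaking vertices, and one on the right, after applying the involution, does the
    same for [H2]. *)
Lemma ideal_gen_orthogonal H1 H2 v1 v2 x :
  hereditary H1 -> hereditary H2 -> H1 `&` H2 = set0 ->
  (H1 `|` breaking H1) v1 -> (H2 `|` breaking H2) v2 ->
  ideal_gen H1 v1 ** x ** ideal_gen H2 v2 = 0.
Proof.
move=> h1 h2 H12 v1H v2H.
elim: (span_monos x) => [|k _ y [p [q [w ->]]] _ IH].
  by rewrite amul0r amul0l.
rewrite amulDr amulDl IH addr0 amulZr amulZl /mono amulA -amulA.
have [->|w1] := ideal_gen_rpath p w h1 v1H; first by rewrite amul0l scaler0.
have [qz|w2] := ideal_gen_rpath q w h2 v2H.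
  rewrite -[gstpath _ _ ** _]starK starM star_ideal_gen /gstpath starK qz.
  by rewrite star0 amul0r scaler0.
by case: (breaking_disjoint h1 h2 H12 w1 w2).
Qed.

(** The middle factor [y] makes this a two-sided ideal for an arbitrary set [B]. *)
Definition annihilator (B : set L) : set L :=
  [set x | forall b y, B b -> x ** y ** b = 0 /\ b ** y ** x = 0].

Lemma annihilator_ideal B : two_sided_ideal (annihilator B).
Proof.
split.
- by move=> b y _; rewrite !amul0l amul0r.
- move=> x x' hx hx' b y Bb; have [xb bx] := hx b y Bb.
  by have [xb' bx'] := hx' b y Bb; rewrite !amulDl amulDr xb bx xb' bx' addr0.
- move=> k x hx b y Bb; have [xb bx] := hx b y Bb.
  by rewrite !amulZl amulZr xb bx scaler0.
- move=> a x hx; split=> b y Bb.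
    have [xb _] := hx b y Bb; have [_ bx] := hx b (y ** a) Bb.
    by rewrite -!amulA (amulA x) xb amul0r !amulA -(amulA b) bx.
  have [xb _] := hx b (a ** y) Bb; have [_ bx] := hx b y Bb.
  by rewrite amulA bx amul0l -(amulA x) xb.
Qed.

Definition ideal_gens H : set L :=
  [set x | exists2 v, (H `|` breaking H) v & x = ideal_gen H v].

(** Prefixing an edge lengthens compatible paths, so by induction on their maximal length the ranges
    of the edges out of [v] lie in [T]. A breaking [v] is its generator plus a finite sum of
    [e e^*]; any other [v] outside both sets is regular and saturation applies. *)
Lemma ideal_gens_vertices H1 H2 (T : set L) : two_sided_ideal T ->
  ideal_gens H1 `<=` T -> ideal_gens H2 `<=` T ->
  (forall v : vertex E, (~` (H1 `|` H2)) v ->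
    (compatible_from H1 v `|` compatible_from H2 v) !=set0 /\
    finite_set (compatible_from H1 v `|` compatible_from H2 v)) ->
  forall v, T (vtx v).
Proof.
move=> idT T1 T2 comp; have [T0 TD TZ TM] := idT.
have TH v : (H1 `|` H2) v -> T (vtx v).
  move=> [] Hv; [apply: T1|apply: T2]; exists v; try by left.
    by rewrite /ideal_gen asboolT.
  by rewrite /ideal_gen asboolT.
suff bounded n v :
    (forall p, (compatible_from H1 v `|` compatible_from H2 v) p ->
      (size p <= n)%N) -> T (vtx v).
  move=> v; have [/TH //|Gv] := pselect ((H1 `|` H2) v).
  by have [_ /finite_set_seq_bound[n /bounded]] := comp v Gv.
elim: n v => [|n IH] v bound; have [/TH //|Gv] := pselect ((H1 `|` H2) v).
  have [[p cp] _] := comp v Gv; have := bound p cp.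
  by case: cp => -[q [e [w [-> _ _ _]]]]; rewrite size_rcons.
have [[p0 cp0] cfin] := comp v Gv.
have Tedge e : src e = v -> T (vtx (rng e)).
  move=> ev; apply: IH => p cp; apply: (bound (e :: p)); rewrite -ev.
  by case: cp => /compatible_cons; [left|right].
have Tgen H : T (ideal_gen H v) -> ~ H v -> breaking H v -> T (vtx v).
  move=> TH' nHv [_ _ _ fv].
  rewrite -[vtx v](subrK (\sum_(e <- fset_set
    (emitted v `&` (@rng E @^-1` ~` H))) edg e ** gst e)).
  apply: TD; first by move: TH'; rewrite /ideal_gen asboolF.
  by apply: ideal_edges => // e; rewrite in_fset_set // inE => -[/Tedge].
have [b1|nb1] := pselect (breaking H1 v).
  apply: (Tgen H1) => //; last by move=> ?; apply: Gv; left.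
  by apply: T1; exists v => //; right.
have [b2|nb2] := pselect (breaking H2 v).
  apply: (Tgen H2) => //; last by move=> ?; apply: Gv; right.
  by apply: T2; exists v => //; right.
have [e0 e0v] : exists e, src e = v.
  by case: cp0 => /compatible_inv[e ev _]; exists e.
apply: (ideal_saturated idT); last by move=> _ [e ev <-]; apply: Tedge.
split; first by move=> sv; have : emitted v e0 by []; rewrite sv.
(* Every edge out of [v] is the first edge of some compatible path, and these are finitely many.
   They are nonempty, so the default [e0] is never returned on them. *)
apply; apply: sub_finite_set (finite_image (head e0) cfin) => e ev.
have [eG|eG] := pselect ((H1 `|` H2) (rng e)).
  exists [:: e] => //; rewrite -ev.
  case: eG => eH; [left|right]; apply: compatible_edge => //; rewrite ev => -[].
  - by move=> ?; apply: Gv; left.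
  - exact: nb1.
  - by move=> ?; apply: Gv; right.
  - exact: nb2.
have [[p cp] _] := comp _ eG; exists (e :: p) => //; rewrite -ev.
by case: cp => /compatible_cons; [left|right].
Qed.

Lemma ideal_gens_annihilator H1 H2 :
  hereditary H1 -> hereditary H2 -> H1 `&` H2 = set0 ->
  ideal_gens H1 `<=` annihilator (ideal_gens H2).
Proof.
move=> h1 h2 H12 _ [v1 v1H ->] _ y [v2 v2H ->].
by split; apply: ideal_gen_orthogonal; rewrite // setIC.
Qed.

Lemma annihilator_neq0 H1 H2 : H1 <> set0 ->
  hereditary H1 -> hereditary H2 -> H1 `&` H2 = set0 ->
  annihilator (ideal_gens H2) <> [set 0].
Proof.
move=> /eqP/set0P[v v1] h1 h2 H12 an0; apply: (@vtx_neq0 v).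
have : ideal_gens H1 (vtx v) by exists v; [left|rewrite /ideal_gen asboolT].
by move=> /(ideal_gens_annihilator h1 h2 H12); rewrite an0.
Qed.

End SumOfIdeals.

Lemma direct_sumC (I J : set L) : direct_sum I J -> direct_sum J I.
Proof.
move=> [IJ IJa]; split=> [|a]; first by rewrite setIC.
by have [x [y [Ix Jy ->]]] := IJa a; exists y, x; split; rewrite // addrC.
Qed.

End LeavittPathAlgebra.

Theorem theorem6p5 (K : fieldType) (E : digraph) :
  decomposable (leavitt_path_algebra K E) <->
  exists H1 H2 : set (vertex E),
    [/\ nontrivial H1 /\ nontrivial H2,
        hereditary H1 /\ saturated H1,
        hereditary H2 /\ saturated H2,
        H1 `&` H2 = set0 &
        forall v : vertex E, (~` (H1 `|` H2)) v ->
          (compatible_from H1 v `|` compatible_from H2 v) !=set0 /\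
          finite_set (compatible_from H1 v `|` compatible_from H2 v)].
Proof.
split=> [[I [J [idI idJ nI nJ dIJ]]]|].
  have dJI := direct_sumC dIJ.
  pose H1 : set (vertex E) := [set v | I (vtx v)].
  pose H2 : set (vertex E) := [set v | J (vtx v)].
  have h1 : hereditary H1 := ideal_hereditary idI.
  have h2 : hereditary H2 := ideal_hereditary idJ.
  have H12 : H1 `&` H2 = set0.
    rewrite -subset0 => v [Iv Jv].
    exact: (@vtx_neq0 K E v (ideal_inter0 dIJ Iv Jv)).
  have out u : ~ (H1 `|` H2) u ->
      emitted u `&` (@rng E @^-1` ~` H1) !=set0 /\
      emitted u `&` (@rng E @^-1` ~` H2) !=set0.
    move=> Gu; have [n1 n2] : ~ H1 u /\ ~ H2 u.
      by split=> ?; apply: Gu; [left|right].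
    by split; [apply: (escaping_edge idI idJ dIJ)|
               apply: (escaping_edge idJ idI dJI)].
  have compat v : ~ (H1 `|` H2) v ->
    [/\ H1 !=set0, H2 !=set0,
      compatible_from H1 v `|` compatible_from H2 v !=set0 &
      finite_set (compatible_from H1 v `|` compatible_from H2 v)].
    move=> Gv; have [n bound] := long_paths idI idJ dIJ v.
    apply: (compatible_exists (n := n)) => //.
    exact: (almost_all_edges idI idJ dIJ).
  (* As [I] is nonzero, some vertex is not in [J]; it lies in [I], or outside both sets, where
     [compat] applies. *)
  have H10 : H1 !=set0.
    have [v nJv] := ideal_component_neq0 idI idJ dIJ nI.
    have [[Iv|//]|/compat[]//] := pselect ((H1 `|` H2) v).
    by exists v.
  have H20 : H2 !=set0.
    have [v nIv] := ideal_component_neq0 idJ idI dJI nJ.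
    have [[//|Jv]|/compat[]//] := pselect ((H1 `|` H2) v).
    by exists v.
  exists H1, H2; split=> //.
  - split; split; try exact/eqP/set0P.
      move=> H1T; have [v v2] := H20.
      by apply: (disjoint_absurd H12 _ v2); rewrite H1T.
    move=> H2T; have [v v1] := H10.
    by apply: (disjoint_absurd H12 v1); rewrite H2T.
  - by split=> //; apply: ideal_saturated.
  - by split=> //; apply: ideal_saturated.
  - by move=> v /compat[].
move=> [H1 [H2 [[[H10 _] [H20 _]] [h1 _] [h2 _] H12 compat]]].
have H21 : H2 `&` H1 = set0 by rewrite setIC.
pose I : set (leavitt_path_algebra K E) := annihilator (ideal_gens H2).
pose J : set (leavitt_path_algebra K E) := annihilator (ideal_gens H1).
have idI : two_sided_ideal I := annihilator_ideal _.
have idJ : two_sided_ideal J := annihilator_ideal _.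
have genI : ideal_gens H1 `<=` I := ideal_gens_annihilator h1 h2 H12.
have genJ : ideal_gens H2 `<=` J := ideal_gens_annihilator h2 h1 H21.
have vertices := fun T idT T1 T2 =>
  @ideal_gens_vertices K E H1 H2 T idT T1 T2 compat.
have nI : I <> [set 0] := annihilator_neq0 H10 h1 h2 H12.
have nJ : J <> [set 0] := annihilator_neq0 H20 h2 h1 H21.
exists I, J; split=> //.
have [I0 ID IZ IM] := idI; have [J0 JD JZ JM] := idJ; split.
  apply/seteqP; split=> [x [Ix Jx]|_ ->] //=.
  have [s ->] := sum_vtx x; apply: big1 => v _.
  (* This ideal contains the generators for [H1] because [x] is in [J], and those for [H2] because
     [x] is in [I]; hence it contains every vertex, and [x v = 0]. *)
  pose T : set (leavitt_path_algebra K E) :=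
    [set t | forall y, x ** y ** t = 0].
  have idT : two_sided_ideal T.
    split.
    - by move=> y; rewrite amul0r.
    - by move=> t t' xt xt' y; rewrite amulDr xt xt' addr0.
    - by move=> k t xt y; rewrite amulZr xt scaler0.
    - move=> a t xt; split=> y; first by rewrite amulA -(amulA x) xt.
      by rewrite amulA xt amul0l.
  have Tv : T (vtx v).
    apply: vertices => // t gt y; first by have [] := Jx t y gt.
    by have [] := Ix t y gt.
  by rewrite -(vtxid v) amulA; apply: Tv.
pose T : set (leavitt_path_algebra K E) :=
  [set t | exists x y, [/\ I x, J y & t = x + y]].
have idT : two_sided_ideal T.
  split.
  - by exists 0, 0; rewrite addr0.
  - move=> _ _ [x [y [Ix Jy ->]]] [x' [y' [Ix' Jy' ->]]].
    by exists (x + x'), (y + y'); split; [exact: ID|exact: JD|rewrite addrACA].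
  - move=> k _ [x [y [Ix Jy ->]]]; exists (k *: x), (k *: y).
    by split; [exact: IZ|exact: JZ|rewrite scalerDr].
  - move=> a _ [x [y [/(IM a)[ax xa] /(JM a)[ay ya] ->]]]; split.
      by exists (a ** x), (a ** y); rewrite amulDr.
    by exists (x ** a), (y ** a); rewrite amulDl.
have Tv v : T (vtx v).
  apply: vertices => // t gt.
    by exists t, 0; split; rewrite ?addr0 //; apply: genI.
  by exists 0, t; split; rewrite ?add0r //; apply: genJ.
move=> a; have [s ->] := sum_vtx a; apply: (ideal_sum idT) => v _.
by have [_ _ _ TM] := idT; apply: (TM _ _ (Tv v)).1.
Qed.
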